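(* Let $\nu$ be a corner-symmetric partition and let $\mu$ be a partition with $|\mu|=|\nu|+1$, $\nu\subseteq\mu$ and $\mu\neq\nu+(1)$ (where $\nu+(1)$ is obtained from $\nu$ by adding a box at the end of its first row). Then $\mu$ does not cover $\nu$.
   Context: $\lambda'$ is the conjugate, $|\lambda|$ the size, $\ell(\lambda)$ the number of nonzero parts, $\mu\subseteq\lambda$ means $\mu_i\le\lambda_i$ for all $i$. For $\mu\subseteq(m^m)$, $\mu^c=(m-\mu_m,\dots,m-\mu_1)$ is its complement in $(m^m)$. A symmetric function is Schur-positive if all its Schur coefficients are nonnegative. For partitions $\nu\subseteq\mu$ with $|\mu|=|\nu|+1$, $\mu$ covers $\nu$ if $s_{\mu'}s_{\mu^c}-s_{\nu'}s_{\nu^c}$ is Schur-positive, both complements in the same square $(m^m)$ with $m\ge\mu_1+\ell(\mu)$. An outer corner of $\nu$ is a position $(k,j)$ (row $k$, column $j$) not in the Young diagram of $\nu$ such that adding a box there yields a Young diagram. A partition $\nu$ is corner-symmetric if for every outer corner $(k,j)$ of $\nu$ with $k>1$ there is a nonempty partition $\eta_{k,j}\subseteq\nu$ such that the skew shape $\nu/\eta_{k,j}$ is (a translate of) the Young diagram of a self-conjugate partition, contains the box $(k-1,j)$ of $\nu$, and contains no box from the first $j-1$ columns of $\nu$. *)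

(* Defs.v *)
From mathcomp Require Import all_boot all_order all_algebra.
From mathcomp.multinomials Require Import mpoly.

Set Implicit Arguments.
Unset Strict Implicit.
Unset Printing Implicit Defensive.

Import GRing.Theory.

(* A partition is the weakly decreasing list of its nonzero parts, so its
   length is [size], its size is [sumn], and part i (0-indexed, 0 beyond the
   length) is [nth 0 la i]. *)
Definition is_partition (la : seq nat) : bool :=
  sorted geq la && (0 \notin la).

Definition conjugate (la : seq nat) : seq nat :=
  mkseq (fun j => count (fun x => j < x) la) (head 0 la).

Definition part_incl (mu la : seq nat) : Prop :=
  forall i : nat, nth 0 mu i <= nth 0 la i.

(* (m - mu_m, ..., m - mu_1), without its zero entries; only meaningful for
   mu contained in (m^m). *)
Definition complement (m : nat) (mu : seq nat) : seq nat :=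
  [seq x <- mkseq (fun i => m - nth 0 mu (m - i.+1)) m | x != 0].

(* nu + (1) *)
Definition add_box_row1 (nu : seq nat) : seq nat :=
  (head 0 nu).+1 :: behead nu.

(* Boxes are pairs (row, column), both numbered from 0. *)
Definition diagram (la : seq nat) (p : nat * nat) : bool :=
  p.2 < nth 0 la p.1.

Definition skew_diagram (la mu : seq nat) (p : nat * nat) : bool :=
  diagram la p && ~~ diagram mu p.

Definition outer_corner (nu : seq nat) (p : nat * nat) : Prop :=
  ~~ diagram nu p /\
  exists la : seq nat, is_partition la /\
    forall q : nat * nat, diagram la q = diagram nu q || (q == p).

Definition self_conjugate (rho : seq nat) : Prop := conjugate rho = rho.

(* Natural-number offsets (a, b) suffice: all boxes have nonnegative
   coordinates and the diagram of a nonempty rho contains (0, 0). *)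
Definition self_conjugate_shape (S : nat * nat -> bool) : Prop :=
  exists (rho : seq nat) (a b : nat),
    [/\ is_partition rho, self_conjugate rho &
      forall i j : nat,
        S (i, j) = [&& a <= i, b <= j & diagram rho (i - a, j - b)]].

(* With 0-indexed positions, the condition k > 1 reads 0 < k, and the first
   j - 1 columns are the columns of index < j. *)
Definition corner_symmetric (nu : seq nat) : Prop :=
  forall k j : nat, outer_corner nu (k, j) -> 0 < k ->
    exists eta : seq nat,
      [/\ is_partition eta, eta <> [::] & part_incl eta nu] /\
      [/\ self_conjugate_shape (skew_diagram nu eta),
          skew_diagram nu eta (k.-1, j) &
          forall i l : nat, l < j -> ~~ skew_diagram nu eta (i, l)].

(* The boxes of the diagram of a partition la, as a finite type. *)
Definition box (la : seq nat) : finType :=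
  {p : 'I_(size la) * 'I_(head 0 la) |
     diagram la (nat_of_ord p.1, nat_of_ord p.2)}.

Definition row_of (la : seq nat) (p : box la) : nat := (val p).1.
Definition col_of (la : seq nat) (p : box la) : nat := (val p).2.

Definition semistandard (la : seq nat) (n : nat)
    (T : {ffun box la -> 'I_n}) : bool :=
  [forall p : box la, forall q : box la,
     ((row_of p == row_of q) && (col_of p <= col_of q) ==> (T p <= T q)) &&
     ((col_of p == col_of q) && (row_of p < row_of q) ==> (T p < T q))].

Local Open Scope ring_scope.

(* The Schur polynomial s_la(x_1, ..., x_n). *)
Definition schur (la : seq nat) (n : nat) : {mpoly int[n]} :=
  \sum_(T : {ffun box la -> 'I_n} | semistandard T) \prod_(p : box la) 'X_(T p).

(* A symmetric function is given by its specialisations f n = f(x_1, ..., x_n)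
   for all n; operations and equalities hold for every n simultaneously, in
   particular the coefficients c do not depend on n. *)
Definition schur_positive (f : forall n : nat, {mpoly int[n]}) : Prop :=
  exists (r : seq (seq nat)) (c : seq nat -> int),
    [/\ uniq r,
        forall la, la \in r -> is_partition la /\ 0 <= c la &
        forall n : nat, f n = \sum_(la <- r) c la *: schur la n].

(* mu covers nu, for nu contained in mu with |mu| = |nu| + 1.  Any side m of
   the square with m >= mu_1 + l(mu) is allowed. *)
Definition covers (mu nu : seq nat) : Prop :=
  exists m : nat, (head 0%N mu + size mu <= m)%N /\
    schur_positive (fun n =>
      schur (conjugate mu) n * schur (complement m mu) n
      - schur (conjugate nu) n * schur (complement m nu) n).

(* Main.v *)
From Pilot Require Import Defs.
From mathcomp Require Import all_boot all_order all_algebra.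
From mathcomp Require Import fingroup perm zify ring.
From mathcomp.multinomials Require Import mpoly.
Import Pilot.Defs.

Set Implicit Arguments.
Unset Strict Implicit.
Unset Printing Implicit Defensive.

Import GRing.Theory Num.Theory.

(** Let [mu] be [nu] with a box added at [(k, j)], [0 < k] (everything is
    0-indexed), and let the self-conjugate [rho = nu/eta] occupy the rows [>= a]
    and the columns [>= j] of [nu], with [d] rows, [k = a + d].

    Suppose that [s_(mu') s_(mu^c) - s_(nu') s_(nu^c)] is Schur-positive.  Removing
    horizontal (vertical) strips of a given size preserves Schur-positivity: this
    is the adjoint of multiplication by [h_p] ([e_p]).  For the largest possible [p]
    it removes the first row (column) of both factors of a product.  The boxes of
    [mu] and [nu] differ only outside the first [j] columns and the first [a] rows,
    so [j] such row removals and [a] column removals apply simultaneously to both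
    products.  What remains of [la = mu, nu] is [s_(sg')] times the Schur function of
    the complement of [la] in an [(m - j) x (m - a)] rectangle, [sg] being the part of
    [la] in the rows [>= a] and the columns [>= j].  In it the complement of [eta] has
    coefficient [<s_(la/eta), s_(sg')> = [sg' = sg]], because [la/eta] is a translate
    of [sg].  For [nu] this is 1, as [sg = rho]; for [mu] it is 0, as [sg] is then
    [rho] with an additional row of length one.  The difference thus has the negative
    coefficient [-1].

    Coefficients are read off through [a_delta s_la = a_(la + delta)], which follows
    from the branching rule by column operations on the alternant. *)

(** * Shapes and the branching rule *)

Section Shapes.

Variable N : nat.

(** A finite type, so that sums over shapes are plain big operators. It also contains
    non-partitions; [is_part] singles out the partitions inside the [N x N] square. *)
Definition shape := {ffun 'I_N -> 'I_N.+1}.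

Implicit Types (la ka ro : shape) (i j n : nat).

Definition part la i : nat := if insub i is Some i' then la i' else 0.

Lemma part_ord la (i : 'I_N) : part la i = la i.
Proof. by rewrite /part valK. Qed.

Lemma part_default la i : N <= i -> part la i = 0.
Proof. by move=> leNi; rewrite /part insubF // ltnNge leNi. Qed.

Lemma part_le la i : part la i <= N.
Proof. by rewrite /part; case: insubP => // j _ _; rewrite -ltnS. Qed.

Lemma part_inj la ka : (forall i, part la i = part ka i) -> la = ka.
Proof.
by move=> eq; apply/ffunP => i; apply/val_inj; rewrite /= -!part_ord.
Qed.

Definition mkshape (f : nat -> nat) : shape := [ffun i : 'I_N => inord (f i)].

Lemma part_mkshape f i : i < N -> f i <= N -> part (mkshape f) i = f i.
Proof.
by move=> ltiN lefN; rewrite (part_ord _ (Ordinal ltiN)) ffunE inordK.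
Qed.

Lemma part_mkshapeE f i : (forall i, f i <= N) -> (forall i, N <= i -> f i = 0) ->
  part (mkshape f) i = f i.
Proof.
move=> lef f0; case: (ltnP i N) => ltiN; first exact: part_mkshape.
by rewrite part_default ?f0.
Qed.

Definition shape0 : shape := mkshape (fun=> 0).

Lemma part0 i : part shape0 i = 0.
Proof. by rewrite part_mkshapeE. Qed.

Definition is_part la := [forall i : 'I_N, part la i.+1 <= part la i].

Lemma is_partP la : reflect (forall i, part la i.+1 <= part la i) (is_part la).
Proof.
apply: (iffP forallP) => [H i|H i]; last exact: H.
case: (ltnP i N) => ltiN; first exact: (H (Ordinal ltiN)).
by rewrite part_default // leqW.
Qed.

Lemma is_part_le la : is_part la -> forall i j, i <= j -> part la j <= part la i.
Proof.
move=> /is_partP H i j /subnK <-; elim: (j - i) => // d IH.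
exact: leq_trans (H _) IH.
Qed.

Lemma is_part0 : is_part shape0.
Proof. by apply/is_partP => i; rewrite !part0. Qed.

Definition area la := \sum_(i < N) part la i.

(** Interlacing already forces both shapes to be partitions ([hstrip_is_part]). The row bounds of
    [vstrip] do not, hence its explicit conjunct. *)
Definition hstrip la ka :=
  [forall i : 'I_N, part la i.+1 <= part ka i <= part la i].

Lemma hstripP la ka :
  reflect (forall i, part la i.+1 <= part ka i <= part la i) (hstrip la ka).
Proof.
apply: (iffP forallP) => [H i|H i]; last exact: H.
case: (ltnP i N) => ltiN; first exact: (H (Ordinal ltiN)).
by rewrite !part_default // leqW.
Qed.

Definition vstrip la ka :=
  is_part ka && [forall i : 'I_N, (part la i).-1 <= part ka i <= part la i].

Lemma vstripP la ka :
  reflect (is_part ka /\ forall i, (part la i).-1 <= part ka i <= part la i)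
          (vstrip la ka).
Proof.
apply: (iffP andP) => -[ispka H]; split=> //; last by apply/forallP=> i; exact: H.
move/forallP: H => H i; case: (ltnP i N) => ltiN; first exact: (H (Ordinal ltiN)).
by rewrite !part_default.
Qed.

Lemma hstrip_is_part la ka : hstrip la ka -> is_part la && is_part ka.
Proof.
move=> /hstripP H; apply/andP; split; apply/is_partP => i.
  by case/andP: (H i); apply: leq_trans.
case/andP: (H i.+1) => _ le1; apply: leq_trans le1 _.
by case/andP: (H i).
Qed.

Lemma sub_area la ka : (forall i, part ka i <= part la i) -> area ka <= area la.
Proof. by move=> H; apply: leq_sum. Qed.

Lemma hstrip_area la ka : hstrip la ka -> area ka <= area la.
Proof. by move=> /hstripP H; apply: sub_area => i; case/andP: (H i). Qed.

Lemma vstrip_area la ka : vstrip la ka -> area ka <= area la.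
Proof. by move=> /vstripP [_ H]; apply: sub_area => i; case/andP: (H i). Qed.

Lemma hstrip0 ka : hstrip shape0 ka = (ka == shape0).
Proof.
apply/hstripP/eqP => [H|-> i]; last by rewrite !part0.
apply: part_inj => i; rewrite part0; apply/eqP; rewrite -leqn0.
by case/andP: (H i) => _; rewrite part0.
Qed.

Local Open Scope ring_scope.

(* [schurv n la x] is [s_la(x_0, ..., x_(n-1))], defined by the branching rule. *)
Fixpoint schurv (R : comNzRingType) n la (x : nat -> R) : R :=
  if n is n'.+1 then
    \sum_(ka | hstrip la ka) x n' ^+ (area la - area ka) * schurv n' ka x
  else (la == shape0)%:R.

Section Ring.
Variable R : comNzRingType.
Implicit Types x : nat -> R.

Lemma schurv_ext n la x y : (forall i, (i < n)%N -> x i = y i) -> schurv n la x = schurv n la y.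
Proof.
elim: n la => //= n IH la eqxy;  apply: eq_bigr => ka _.
by rewrite eqxy // IH // => i ltin; rewrite eqxy // ltnW.
Qed.

Lemma schurv_shape0 n x : schurv n shape0 x = 1.
Proof.
elim: n => /= [|n IH]; first by rewrite eqxx.
rewrite (bigD1 shape0) ?hstrip0 //= subnn expr0 mul1r IH big1 ?addr0 //.
by move=> ka; rewrite hstrip0 => /andP [/eqP ->]; rewrite eqxx.
Qed.

(** By interlacing, each variable lowers the number of rows by at most one, and with no variables
    left only the empty shape survives. *)
Lemma schurv_long n la x : (0 < part la n)%N -> schurv n la x = 0.
Proof.
elim: n la => [|n IH] la lapos /=.
  by case: eqP lapos => // ->; rewrite part0.
rewrite big1 // => ka /hstripP /(_ n) /andP [leka _].
by rewrite IH ?mulr0 // (leq_trans lapos).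
Qed.

End Ring.

Lemma schurv_morph (R R' : comNzRingType) (f : {rmorphism R -> R'}) n la x :
  f (schurv n la x) = schurv n la (f \o x).
Proof.
elim: n la => /= [|n IH] la; first by rewrite rmorph_nat.
rewrite rmorph_sum; apply: eq_bigr => ka _.
by rewrite rmorphM rmorphXn IH.
Qed.

End Shapes.

(** * Semistandard tableaux *)

(** A down-closed predicate holds on an initial segment, whose length is the count. This turns
    counts into row lengths. *)
Lemma count_downset (P : pred nat) n i :
  (forall i j, i <= j -> P j -> P i) ->
  (i < count P (iota 0 n)) = (i < n) && P i.
Proof.
move=> downP; elim: n => [|n IH] //.
rewrite -(addn1 n) iotaD count_cat /= addn0 add0n.
have le_count : count P (iota 0 n) <= n by rewrite -{2}(size_iota 0 n) count_size.
case Pn: (P n); last first.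
  rewrite addn0 IH addn1 ltnS [in RHS]leq_eqVlt.
  by case: (i =P n) => [->|] //; rewrite Pn andbF.
suff ->: count P (iota 0 n) = n.
  by rewrite addn1; case: ltnP => //; rewrite ltnS => /downP ->.
apply/eqP; rewrite -{2}(size_iota 0 n) -all_count; apply/allP => j.
by rewrite mem_iota add0n => /andP [_ /ltnW /downP]; apply.
Qed.

Section Tableaux.

Variables (N K : nat) (R : comNzRingType) (x : nat -> R).

Let grid : finType := ('I_N * 'I_N)%type.
Let filling := {ffun grid -> 'I_K.+1}.

Implicit Types (la ka : shape N) (f : filling) (p q : grid).

Definition in_shape la p := p.2 < part la p.1.

Definition sstd la f := [forall p, forall q, in_shape la p ==> in_shape la q ==>
  ((p.1 == q.1) && (p.2 <= q.2) ==> (f p <= f q)) &&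
  ((p.2 == q.2) && (p.1 < q.1) ==> (f p < f q))].

(** Fillings live on the whole grid; fixing the value [ord0] outside the shape makes each tableau
    occur exactly once. *)
Definition filled n la f :=
  sstd la f && [forall p, if in_shape la p then f p < n else f p == ord0].

Lemma sstdP la f : reflect
  (forall p q, in_shape la p -> in_shape la q ->
     (p.1 = q.1 -> p.2 <= q.2 -> f p <= f q) /\
     (p.2 = q.2 -> p.1 < q.1 -> f p < f q)) (sstd la f).
Proof.
apply: (iffP forallP) => [H p q dp dq|H p].
  move/forallP: (H p) => /(_ q); rewrite dp dq /= => /andP [/implyP H1 /implyP H2].
  by split=> [e l|e l]; [apply: H1 | apply: H2]; rewrite e eqxx.
apply/forallP => q; apply/implyP => dp; apply/implyP => dq.
by apply/andP; case: (H p q dp dq) => H1 H2; split; apply/implyP => /andP [/eqP];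
  [exact: H1 | exact: H2].
Qed.

Lemma filledP n la f : reflect
  [/\ sstd la f, forall p, in_shape la p -> f p < n & forall p, ~~ in_shape la p -> f p = ord0]
  (filled n la f).
Proof.
apply: (iffP andP) => [[ss /forallP H]|[ss H1 H2]]; split=> //.
- by move=> p dp; move: (H p); rewrite dp.
- by move=> p dp; move: (H p); rewrite (negbTE dp) => /eqP.
by apply/forallP => p; case: ifPn => [/H1|/H2 ->].
Qed.

Lemma in_shape_inj la ka : (forall p, in_shape la p = in_shape ka p) -> la = ka.
Proof.
move=> eqd; apply: part_inj => i.
case: (ltnP i N) => ltiN; last by rewrite !part_default.
have H la1 la2 : (forall p, in_shape la1 p = in_shape la2 p) -> part la1 i <= part la2 i.
  move=> eqd12; rewrite leqNgt; apply/negP => lt12.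
  have ltN : part la2 i < N by apply: leq_trans lt12 (part_le _ _).
  by have := eqd12 (Ordinal ltiN, Ordinal ltN); rewrite /in_shape /= lt12 ltnn.
by apply/eqP; rewrite eqn_leq !H.
Qed.

Lemma card_in_shape la : #|[pred p | in_shape la p]| = area la.
Proof.
rewrite -sum1_card (eq_bigl (fun p => true && in_shape la (p.1, p.2))); last by case.
rewrite -(pair_big_dep xpredT (fun i j => in_shape la (i, j)) (fun _ _ => 1)) /=.
apply: eq_bigr => i _; rewrite sum1_card -[RHS]card_ord.
rewrite -(card_image (f := widen_ord (part_le la i))); last first.
  by move=> u v /(congr1 val) /= /val_inj.
apply: eq_card => j; apply/idP/imageP => [ltj|[k _ ->]]; last first.
  by rewrite unfold_in /in_shape /=; exact: (ltn_ord k).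
by exists (Ordinal (ltj : j < part la i)) => //; apply: val_inj.
Qed.

Lemma card_in_shapeD la ka : (forall p, in_shape ka p -> in_shape la p) ->
  #|[pred p | in_shape la p && ~~ in_shape ka p]| = area la - area ka.
Proof.
move=> sub; rewrite -!card_in_shape -(cardID [pred p | in_shape ka p] [pred p | in_shape la p]).
rewrite (_ : #|[predI _ & _]| = #|[pred p | in_shape ka p]|) ?addKn; last first.
  apply: eq_card => p; rewrite !inE /=; apply/andP/idP => [[]|d] //.
  by split=> //; apply: sub.
by apply: eq_card => p; rewrite !inE /= andbC.
Qed.

(** The shape formed by the entries less than [n]. The inequality [c <= p.2] makes the counted
    predicate down-closed for every [f], so that [count_downset] applies. *)
Definition below n la f : shape N :=
  mkshape N (fun i => count (fun c => [exists p : grid,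
     [&& p.1 == i :> nat, c <= p.2, in_shape la p & f p < n]]) (iota 0 N)).

Lemma in_shape_below n m la f p : filled m la f ->
  in_shape (below n la f) p = in_shape la p && (f p < n).
Proof.
move=> /filledP [/sstdP ss _ _]; rewrite {1}/in_shape part_mkshape //; last first.
  by apply: leq_trans (count_size _ _) _; rewrite size_iota.
rewrite count_downset; last first.
  move=> i j leij /existsP [q /and4P [e l d ltn]]; apply/existsP; exists q.
  by rewrite e d ltn (leq_trans leij).
rewrite ltn_ord /=; apply/existsP/andP => [[q /and4P [/eqP e l dq ltn]]|[d ltn]].
  have dp : in_shape la p by rewrite /in_shape -e (leq_ltn_trans l).
  split=> //; apply: leq_ltn_trans ltn; case: (ss p q dp dq) => H _.
  by apply: H => //; apply: val_inj.
by exists p; rewrite eqxx leqnn d ltn.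
Qed.

(** Columns increase strictly, so a box with a box of [la] directly below it cannot carry the
    largest entry [n]. *)
Lemma hstrip_below n la f : is_part la -> filled n.+1 la f -> hstrip la (below n la f).
Proof.
move=> /is_partP is_part_la fil; have/filledP [/sstdP ss H1 _] := fil.
apply/hstripP => i; case: (ltnP i N) => ltiN; last by rewrite !part_default // leqW.
apply/andP; split; rewrite leqNgt; apply/negP => lt.
  have ltc : part (below n la f) i < N by apply: leq_trans lt (part_le _ _).
  have lti1 : i.+1 < N.
    by rewrite ltnNge; apply/negP => leN; rewrite [part la _]part_default in lt.
  pose p : grid := (Ordinal ltiN, Ordinal ltc).
  pose q : grid := (Ordinal lti1, Ordinal ltc).
  have dq : in_shape la q by [].
  have dp : in_shape la p by rewrite /in_shape /= (leq_trans lt).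
  have := in_shape_below n p fil; rewrite {1}/in_shape /= ltnn dp /= => /esym/negP; apply.
  by rewrite -ltnS; apply: leq_trans (H1 q dq); case: (ss p q dp dq) => _; exact.
have ltc : part la i < N by apply: leq_trans lt (part_le _ _).
have := in_shape_below n (Ordinal ltiN, Ordinal ltc) fil.
by rewrite {1}/in_shape /= lt /in_shape /= ltnn.
Qed.

Definition extend_filling n la ka f : filling :=
  [ffun p => if in_shape ka p then f p else if in_shape la p then inord n else ord0].

Definition restrict_filling ka f : filling :=
  [ffun p => if in_shape ka p then f p else ord0].

Lemma hstrip_in_shape la ka : hstrip la ka -> forall p, in_shape ka p -> in_shape la p.
Proof.
by move=> /hstripP H p; rewrite /in_shape => /leq_trans -> //; case/andP: (H p.1).
Qed.

Lemma in_shape_left la p q : p.1 = q.1 -> p.2 <= q.2 -> in_shape la q -> in_shape la p.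
Proof. by rewrite /in_shape => -> /leq_ltn_trans; apply. Qed.

Lemma in_shape_up la p q : is_part la -> p.2 = q.2 -> p.1 <= q.1 -> in_shape la q -> in_shape la p.
Proof.
move=> is_part_la; rewrite /in_shape => -> le /leq_trans; apply; exact: is_part_le.
Qed.

Lemma filled_extend n la ka f : n <= K -> hstrip la ka -> filled n ka f ->
  filled n.+1 la (extend_filling n la ka f).
Proof.
move=> leK hs /filledP [/sstdP ss H1 H2].
have [is_part_la is_part_ka] := andP (hstrip_is_part hs).
apply/filledP; split=> [|p dp|p dp]; rewrite ?ffunE; last first.
- by rewrite (negbTE dp) ifN //; apply: contra dp; apply: hstrip_in_shape.
- by case: ifP => [/H1/ltnW //|_]; rewrite dp inordK.
apply/sstdP => p q dp dq; rewrite !ffunE dp dq.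
split=> [e l|e l].
  case: (boolP (in_shape ka q)) => dkq.
    have dkp := in_shape_left e l dkq; rewrite dkp.
    by case: (ss p q dkp dkq) => H _; exact: H.
  by rewrite (inordK (_ : n < K.+1)) //; case: ifP => [/H1/ltnW|_] //; rewrite inordK.
case: (boolP (in_shape ka q)) => dkq.
  have dkp := in_shape_up is_part_ka e (ltnW l) dkq; rewrite dkp.
  by case: (ss p q dkp dkq) => _; exact.
have dkp : in_shape ka p.
  move/hstripP: hs => /(_ p.1) /andP [le1 _]; rewrite /in_shape; apply: leq_trans le1.
  rewrite e; apply: leq_trans dq _; exact: is_part_le.
by rewrite dkp (inordK (_ : n < K.+1)) // H1.
Qed.

(** Tableaux are sorted by the subshape of their entries less than the largest one. The remaining
    boxes form a horizontal strip and contribute a power of the last variable, which is the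
    branching rule. *)
Lemma filled_sum n la : n <= K.+1 -> is_part la ->
  (\sum_(f | filled n la f) \prod_(p | in_shape la p) x (f p) = schurv n la x)%R.
Proof.
elim: n la => [|n IH] la leK is_part_la /=.
  case: eqP => [->|/eqP nz].
    rewrite (big_pred1 [ffun=> ord0]) ?big_pred0 // => [|f].
      by move=> p; rewrite /in_shape part0.
    apply/filledP/eqP => [[_ _ H]|->].
      by apply/ffunP => p; rewrite ffunE H // /in_shape part0.
    by split=> [|p|p]; rewrite ?ffunE // ?/in_shape ?part0 //; apply/sstdP => p q; rewrite /in_shape part0.
  rewrite big_pred0 // => f; apply/negbTE/negP => /filledP [_ H _].
  case/eqP: nz; apply: in_shape_inj => p; rewrite [RHS]/in_shape part0 ltn0.
  by apply/negbTE/negP => /H.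
rewrite (partition_big (below n la) (hstrip la)); last by move=> f; apply: hstrip_below.
apply: eq_bigr => ka hs; have [_ is_part_ka] := andP (hstrip_is_part hs).
rewrite -IH ?(ltnW leK) // (reindex_onto (extend_filling n la ka) (restrict_filling ka)).
  rewrite big_distrr /=; apply: eq_big => f.
    apply/andP/idP => [[/andP [fil /eqP eqka] /eqP eqf]|fil].
      have/filledP [/sstdP ss H1 H2] := fil.
      have sub := hstrip_in_shape hs.
      have fE p : in_shape ka p -> extend_filling n la ka f p = f p by rewrite ffunE => ->.
      apply/filledP; split=> [|p dp|p dp].
      + apply/sstdP => p q dp dq; rewrite -!fE //; apply: ss; exact: sub.
      + by have := in_shape_below n p fil; rewrite eqka dp fE // => /esym /andP [].
      by rewrite -eqf ffunE (negbTE dp).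
    have fil' := filled_extend leK hs fil; rewrite fil'.
    have/filledP [_ H1 H2] := fil; split.
      apply/eqP/in_shape_inj => p; rewrite (in_shape_below _ _ fil') ffunE.
      case: (boolP (in_shape ka p)) => dp; first by rewrite H1 // (hstrip_in_shape hs).
      by case: ifP => // _; rewrite inordK ?ltnn.
    apply/eqP/ffunP => p; rewrite !ffunE.
    by case: (boolP (in_shape ka p)) => dp //; rewrite H2.
  move=> _; rewrite (bigID (in_shape ka)) /= mulrC; congr (_ * _)%R.
    rewrite -(card_in_shapeD (hstrip_in_shape hs)) -prodr_const; apply: eq_bigr => p /andP [d1 d2].
    by rewrite ffunE (negbTE d2) d1 inordK.
  apply: eq_big => p; first by apply/andP/idP => [[]|d] //; split=> //; apply: (hstrip_in_shape hs).
  by move=> /andP [_ d]; rewrite ffunE d.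
move=> f /andP [fil /eqP eqka]; have/filledP [_ H1 H2] := fil.
apply/ffunP => p; rewrite !ffunE -eqka (in_shape_below _ _ fil).
case: (boolP (in_shape la p)) => dp /=; last by rewrite H2.
case: (ltnP (f p) n) => // le.
by apply: val_inj; rewrite /= inordK //; apply/eqP; rewrite eqn_leq le -ltnS H1.
Qed.

(** Carries the tableaux on the dependent type [box la] over to fillings of the grid, by the
    position map [pos] and its partial inverse [op]. *)
Lemma box_sum (la : seq nat) : sorted geq la -> size la <= N -> head 0 la <= N ->
  (\sum_(T : {ffun box la -> 'I_K.+1} | semistandard T) \prod_(p : box la) x (T p)
   = schurv K.+1 (mkshape N (nth 0 la)) x)%R.
Proof.
move=> sorted_la size_la head_la.
pose pos (b : box la) : grid := (widen_ord size_la (val b).1, widen_ord head_la (val b).2).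
have pos_inj : injective pos.
  move=> [[b1 b2] Hb] [[c1 c2] Hc] [/= e1 e2]; apply: val_inj => /=.
  by congr pair; apply: val_inj.
have nth_mono i j : i <= j -> nth 0 la j <= nth 0 la i.
  move=> leij; case: (ltnP j (size la)) => ltj; last by rewrite nth_default.
  have tr : transitive geq by move=> ? ? ? /[swap]; apply: leq_trans.
  apply: (sorted_leq_nth tr leqnn 0 sorted_la) => //; rewrite inE ?ltj //.
  exact: leq_ltn_trans leij ltj.
have nth_le i : nth 0 la i <= N by apply: leq_trans (nth_mono 0 i _) _; rewrite ?nth0.
have partE i : part (mkshape N (nth 0 la)) i = nth 0 la i.
  by apply: part_mkshapeE => // j leNj; rewrite nth_default // (leq_trans size_la).
set lash := mkshape N (nth 0 la) in partE *.
have is_part_la : is_part lash by apply/is_partP => i; rewrite !partE nth_mono.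
pose op p := [pick b | pos b == p].
have opK b : op (pos b) = Some b.
  rewrite /op; case: pickP => [c /eqP/pos_inj -> //|/(_ b)]; by rewrite eqxx.
have in_shape_pos b : in_shape lash (pos b) by rewrite /in_shape partE /=; case: b => [[b1 b2] Hb].
have opP p : in_shape lash p -> omap pos (op p) = Some p.
  move=> dp; rewrite /op; case: pickP => [b /eqP /= -> //|none].
  rewrite /in_shape partE in dp.
  have l1 : p.1 < size la.
    by rewrite ltnNge; apply/negP => le; rewrite nth_default in dp.
  have l2 : p.2 < head 0 la by rewrite -nth0; apply: leq_trans dp (nth_mono 0 _ _).
  have Hb : diagram la (val (Ordinal l1, Ordinal l2).1, val (Ordinal l1, Ordinal l2).2).
    by [].
  pose b : box la := exist _ (Ordinal l1, Ordinal l2) Hb.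
  suff eqp : pos b = p by have := none b; rewrite /= eqp eqxx.
  by rewrite [RHS]surjective_pairing; congr pair; apply: val_inj.
pose h (T : {ffun box la -> 'I_K.+1}) : filling :=
  [ffun p => if op p is Some b then T b else ord0].
pose h' (f : filling) : {ffun box la -> 'I_K.+1} := [ffun b => f (pos b)].
have hpos T b : h T (pos b) = T b by rewrite ffunE opK.
have hK T : h' (h T) = T by apply/ffunP => b; rewrite ffunE hpos.
rewrite -filled_sum // (reindex_onto h h'); last first.
  move=> f /filledP [_ _ H]; apply/ffunP => p; rewrite ffunE.
  case: (boolP (in_shape lash p)) => dp; first by move/opP: dp; case: (op p) => //= b [<-]; rewrite ffunE.
  rewrite H // /op; case: pickP => // b /eqP eqp; by rewrite -eqp in_shape_pos in dp.
apply: eq_big => T; last first.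
  move=> _; rewrite (reindex_omap pos op opP); apply: eq_big => b; last by rewrite hpos.
  by rewrite in_shape_pos opK eqxx.
rewrite hK eqxx andbT; apply/idP/filledP => [ss|[/sstdP ss _ _]].
  split=> [|p dp|p dp]; last 2 first.
  - exact: ltn_ord.
  - rewrite ffunE /op; case: pickP => // b /eqP eqp; by rewrite -eqp in_shape_pos in dp.
  apply/sstdP => p q /opP + /opP.
  case: (op p) => //= b [<-]; case: (op q) => //= c [<-].
  rewrite !hpos; move/forallP: ss => /(_ b)/forallP /(_ c) /andP [/implyP H1 /implyP H2].
  split=> [/(congr1 val) e l|/(congr1 val) e l]; [apply: H1 | apply: H2];
  by apply/andP; split=> //; apply/eqP.
apply/forallP => b; apply/forallP => c; case: (ss _ _ (in_shape_pos b) (in_shape_pos c)).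
rewrite !hpos => H1 H2; apply/andP; split; apply/implyP => /andP [/eqP e l].
  by apply: H1 => //; apply: val_inj.
by apply: H2 => //; apply: val_inj.
Qed.

End Tableaux.

(** * Horizontal and vertical strips *)

Section Strips.

Variable N : nat.
Implicit Types (la ka ro : shape N).

Lemma sub_area_eq la ka : (forall i, part ka i <= part la i) -> area la <= area ka -> la = ka.
Proof.
move=> sub le; apply: part_inj => i; case: (ltnP i N) => ltiN; last by rewrite !part_default.
apply/eqP; rewrite eqn_leq sub andbT leqNgt; apply/negP => lt.
move: le; rewrite leqNgt => /negP; apply; rewrite /area.
rewrite (bigD1 (Ordinal ltiN)) //= [in X in _ < X](bigD1 (Ordinal ltiN)) //= -addSn.
by apply: leq_add => //; apply: leq_sum.
Qed.

Definition behead_shape la : shape N := mkshape N (fun i => part la i.+1).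
Definition pred_shape la : shape N := mkshape N (fun i => (part la i).-1).

Lemma part_behead la i : part (behead_shape la) i = part la i.+1.
Proof.
by apply: (part_mkshapeE (f := fun i => part la i.+1)) => j *; rewrite ?part_le ?part_default ?leqW.
Qed.

Lemma part_pred la i : part (pred_shape la) i = (part la i).-1.
Proof.
apply: (part_mkshapeE (f := fun i => (part la i).-1)) => j *.
  by apply: leq_trans (leq_pred _) (part_le _ _).
by rewrite part_default.
Qed.

Definition nrows la := \sum_(i < N) (0 < part la i : nat).

Lemma area_behead la : area la = area (behead_shape la) + part la 0.
Proof.
have ->: area (behead_shape la) = \sum_(i < N) part la i.+1.
  by apply: eq_bigr => i _; rewrite part_behead.
have e1 : \sum_(i < N.+1) part la i = part la 0 + \sum_(i < N) part la i.+1.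
  by rewrite big_ord_recl.
have e2 : \sum_(i < N.+1) part la i = area la by rewrite big_ord_recr /= part_default ?addn0.
by rewrite -e2 e1 addnC.
Qed.

Lemma area_pred la : area la = area (pred_shape la) + nrows la.
Proof.
rewrite /area /nrows -big_split; apply: eq_bigr => i _ /=.
by rewrite part_pred; case: (part la i) => //= k; rewrite addn1.
Qed.

(** Interlacing forces [ka] to contain [la] without its first row, so no strip is larger than that
    row. *)
Lemma hstrip_max la ka :
  hstrip la ka -> (area la <= area ka + part la 0) * ((area la == area ka + part la 0) = (ka == behead_shape la)).
Proof.
move=> /hstripP H; have sub i : part (behead_shape la) i <= part ka i.
  by rewrite part_behead; case/andP: (H i).
rewrite area_behead leq_add2r eqn_add2r sub_area //; split=> //.
apply/eqP/eqP => [eqs|-> //]; apply: sub_area_eq => //; by rewrite eqs.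
Qed.

Lemma vstrip_max la ka :
  vstrip la ka -> (area la <= area ka + nrows la) * ((area la == area ka + nrows la) = (ka == pred_shape la)).
Proof.
move=> /vstripP [_ H]; have sub i : part (pred_shape la) i <= part ka i.
  by rewrite part_pred; case/andP: (H i).
rewrite area_pred leq_add2r eqn_add2r sub_area //; split=> //.
apply/eqP/eqP => [eqs|-> //]; apply: sub_area_eq => //; by rewrite eqs.
Qed.

Lemma hstrip_behead la : is_part la -> hstrip la (behead_shape la).
Proof.
by move=> /is_partP H; apply/hstripP => i; rewrite part_behead leqnn H.
Qed.

Lemma is_part_behead la : is_part la -> is_part (behead_shape la).
Proof. by move=> /hstrip_behead /hstrip_is_part /andP []. Qed.

Lemma is_part_pred la : is_part la -> is_part (pred_shape la).
Proof.
by move=> /is_partP H; apply/is_partP => i; rewrite !part_pred; move: (H i); lia.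
Qed.

Lemma vstrip_pred la : is_part la -> vstrip la (pred_shape la).
Proof.
move=> H; apply/vstripP; split=> [|i]; first exact: is_part_pred.
by rewrite part_pred leqnn leq_pred.
Qed.

Local Open Scope ring_scope.

(* Generating functions: the vertical-strip operator E(t) is inverse to the
   horizontal-strip operator H(-t).  The rows of the intermediate shape can be
   chosen independently of each other, and the first row in which [la] and
   [ka] differ contributes two terms of opposite sign. *)
Lemma strip_inversion la ka : is_part la ->
  \sum_(ro | vstrip la ro && hstrip ro ka) (-1) ^+ (area ro - area ka) = (la == ka)%:R :> int.
Proof.
move=> is_part_la; case: (boolP (is_part ka)) => [is_part_ka|nisp]; last first.
  rewrite big_pred0 => [|ro]; first by case: eqP nisp => // <-; rewrite is_part_la.
  by apply/negbTE; apply: contra nisp => /andP [_ /hstrip_is_part /andP []].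
(* The conditions on [ro] decouple: each bounds one row in terms of [la] and [ka] only. That [ro] is
   a partition follows, since [part ro i.+1 <= part ka i <= part ro i]. *)
pose c (i : 'I_N) (t : 'I_N.+1) := [&& (part ka i <= t)%N, (t <= part la i)%N,
  ((part la i).-1 <= t)%N & (i == 0%N :> nat) || (t <= part ka i.-1)%N].
rewrite (eq_big (fun ro => ro \in family c)
  (fun ro : shape N => \prod_i (-1) ^+ (ro i + part ka i)%N)); first last.
- move=> ro /andP [_ /hstrip_area lesz]; rewrite -signr_odd oddB // -oddD signr_odd.
  rewrite /area -big_split /= -prodrXr; apply: eq_bigr => i _.
  by rewrite part_ord.
- move=> ro; apply/andP/familyP => [[/vstripP [_ vs] /hstripP hs] i|H].
    rewrite unfold_in -part_ord; case/andP: (vs i) => -> ->; case/andP: (hs i) => _ ->.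
    by case: i => [[|i] lti] //=; case/andP: (hs i).
  have {}H i : [&& (part ka i <= part ro i)%N, (part ro i <= part la i)%N,
      ((part la i).-1 <= part ro i)%N & (i == 0%N :> nat) || (part ro i <= part ka i.-1)%N].
    case: (ltnP i N) => [ltiN|leN]; last by rewrite !(part_default _ leN) leq0n orbT.
    by move: (H (Ordinal ltiN)); rewrite unfold_in -part_ord.
  split.
    apply/vstripP; split=> [|i]; last by case/and4P: (H i) => _ -> ->.
    apply/is_partP => i; case/and4P: (H i.+1) => _ _ _ /= le; apply: leq_trans le _.
    by case/and4P: (H i).
  apply/hstripP => i; case/and4P: (H i) => -> _ _ _; rewrite andbT.
  by case/and4P: (H i.+1).
rewrite -(bigA_distr_big_dep _ (fun (i : 'I_N) (t : 'I_N.+1) => (-1) ^+ (t + part ka i)%N)) /=.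
case: eqP => [eqlk|/eqP neq].
  rewrite big1 // => i _; rewrite (big_pred1 (la i)).
    by rewrite -part_ord eqlk -signr_odd oddD addbb.
  move=> t; rewrite /c; apply/and4P/eqP => [[h1 h2 _ _]|->].
    by apply/val_inj/eqP; rewrite /= -part_ord eqn_leq h2 eqlk.
  rewrite -part_ord -eqlk leq_pred !leqnn; split=> //.
  case: i => [[|i] lti] //=; exact/is_partP.
case: (boolP [exists i : 'I_N, (part la i < part ka i)%N]) => [/existsP [i lt]|].
  rewrite (bigD1 i) //= big_pred0 ?mul0r // => t; apply/negbTE; rewrite /c.
  by apply/negP => /and4P [h1 h2 _ _]; move: (leq_trans h1 h2); rewrite leqNgt lt.
rewrite negb_exists => /forallP sub.
have {}sub i : (part ka i <= part la i)%N.
  case: (ltnP i N) => ltiN; last by rewrite !part_default.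
  by have := sub (Ordinal ltiN); rewrite -leqNgt.
have ex : exists i, (part ka i < part la i)%N.
  suff /existsP [i lt]: [exists i : 'I_N, (part ka i < part la i)%N] by exists i.
  apply: contraNT neq.
  rewrite negb_exists => /forallP H; apply/eqP; apply: part_inj => i.
  case: (ltnP i N) => ltiN; last by rewrite !part_default.
  by apply/eqP; rewrite eqn_leq sub andbT leqNgt (H (Ordinal ltiN)).
case: (ex_minnP ex) => i lt min; have ltiN : (i < N)%N.
  by rewrite ltnNge; apply/negP => le; rewrite !part_default in lt.
rewrite (bigD1 (Ordinal ltiN)) //=.
have la_gt0 : (0 < part la i)%N by apply: leq_ltn_trans lt.
have ltN : (part la i < N.+1)%N by rewrite ltnS part_le.
have ltN' : ((part la i).-1 < N.+1)%N by apply: leq_ltn_trans (leq_pred _) ltN.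
rewrite (bigD1 (Ordinal ltN)) /=; last first.
  rewrite /c /= leqnn leq_pred sub /=.
  (* Above the first difference the shapes agree, so the bound by [part ka i] admits the value
     [part la i.+1]. *)
  case: i {ltiN lt la_gt0 ltN ltN'} min => [|i] //= min.
  rewrite leqNgt; apply/negP => lt.
  have := min i; rewrite ltnn => H; suff: false by []; apply: H.
  by apply: leq_trans lt _; exact/is_partP.
rewrite (big_pred1 (Ordinal ltN')) => [|t] /=.
  by rewrite -{1}(prednK la_gt0) addSn exprS mulN1r addNr mul0r.
rewrite /c -!val_eqE /=; apply/andP/eqP => [[/and4P [h1 h2 h3 _] /eqP ne]|->].
  by lia.
split; last by lia.
apply/and4P; split=> //; try lia.
case: i {ltiN ltN ltN'} lt min la_gt0 => [|i] //= lt min _.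
rewrite leqNgt; apply/negP => lt'.
have := min i; rewrite ltnn => H; suff: false by []; apply: H.
by have /is_partP/(_ i) := is_part_la; lia.
Qed.

End Strips.

(** * Linear relations between products of two Schur functions *)

Lemma subnDD m n p q : n <= m -> q <= p -> m - n + (p - q) = m + p - (n + q).
Proof. lia. Qed.

Lemma leq_add_tight a b c a' b' c' : a <= b + c -> a' <= b' + c' ->
  a + a' = b + b' + (c + c') -> a == b + c /\ a' == b' + c'.
Proof. by move=> *; split; apply/eqP; lia. Qed.

Section Relations.

Variable N : nat.
Let V : finType := (shape N * shape N)%type.
Implicit Types (p q r : V) (g h : V -> int).

Definition is_part2 p := is_part p.1 && is_part p.2.
Definition hstrip2 p q := hstrip p.1 q.1 && hstrip p.2 q.2.
Definition vstrip2 p q := vstrip p.1 q.1 && vstrip p.2 q.2.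
Definition area2 p := area p.1 + area p.2.

Lemma hstrip2_area p q : hstrip2 p q -> area2 q <= area2 p.
Proof. by move=> /andP [/hstrip_area h1 /hstrip_area h2]; apply: leq_add. Qed.

Lemma vstrip2_area p q : vstrip2 p q -> area2 q <= area2 p.
Proof. by move=> /andP [/vstrip_area h1 /vstrip_area h2]; apply: leq_add. Qed.

Local Open Scope ring_scope.

Definition schurv2 (R : comNzRingType) n p (x : nat -> R) := schurv n p.1 x * schurv n p.2 x.

Lemma schurv2_rec (R : comNzRingType) n p (x : nat -> R) :
  schurv2 n.+1 p x = \sum_(q | hstrip2 p q) x n ^+ (area2 p - area2 q) * schurv2 n q x.
Proof.
rewrite /schurv2 /= big_distrlr /= pair_big /=; apply: eq_bigr => q /andP [h1 h2].
have l1 := hstrip_area h1; have l2 := hstrip_area h2.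
rewrite mulrACA -exprD; congr (_ ^+ _ * _); exact: subnDD.
Qed.

Lemma strip_inversion2 p r : is_part2 p ->
  \sum_(q | vstrip2 p q && hstrip2 q r) (-1) ^+ (area2 q - area2 r) = (p == r)%:R :> int.
Proof.
case: p r => [p1 p2] [r1 r2] /andP [is_part1 is_part2].
rewrite xpair_eqE -mulnb natrM -(strip_inversion r1 is_part1) -(strip_inversion r2 is_part2) /=.
rewrite big_distrlr /= pair_big /=; apply: eq_big => [q|q /andP [vs hs]].
  by rewrite /vstrip2 /hstrip2 /= andbACA.
case/andP: hs => /hstrip_area /= l1 /hstrip_area /= l2; rewrite -exprD; congr (_ ^+ _).
by apply/esym; exact: subnDD.
Qed.

(** The values of [g] are the coefficients of a linear relation. It is required over every ring, so
    that a variable may be replaced by a polynomial indeterminate. *)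
Definition Rel g := forall (R : comNzRingType) (x : nat -> R) n,
  \sum_p (g p)%:~R * schurv2 n.+1 p x = 0.

(** The adjoints of multiplication by [h_k] and, with vertical strips, by [e_k], acting on
    coefficients. By the coproducts of [h_k] and [e_k], they remove strips of total size [k] from
    the two factors of a product. *)
Definition Dop k g q := \sum_(p | hstrip2 p q && (area2 p == area2 q + k)%N) g p.
Definition Eop k g q := \sum_(p | vstrip2 p q && (area2 p == area2 q + k)%N) g p.

Lemma Rel_ext g h : g =1 h -> Rel g -> Rel h.
Proof.
by move=> eq rg R x n; rewrite -[RHS](rg R x n); apply: eq_bigr => p _; rewrite eq.
Qed.

(* Adjoin a variable X and extract the coefficient of X^k. *)
Lemma Rel_D k g : Rel g -> Rel (Dop k g).
Proof.
move=> rg R x n.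
pose x' i : {poly R} := if (i < n.+1)%N then (x i)%:P else 'X.
have Sx' m q : (m <= n.+1)%N -> schurv2 m q x' = (schurv2 m q x)%:P.
  move=> le; have e la : schurv m la x' = (schurv m la x)%:P.
    rewrite (schurv_morph (@polyC R)); apply: schurv_ext => i lti /=.
    by rewrite /x' (leq_trans lti).
  by rewrite /schurv2 !e polyCM.
have := congr1 (fun u : {poly R} => u`_k) (rg _ x' n.+1); rewrite coef0 coef_sum => eq0; rewrite -[RHS]eq0.
rewrite (eq_bigr (fun q => \sum_(p | hstrip2 p q && (area2 p == area2 q + k)%N)
  (g p)%:~R * schurv2 n.+1 q x)); last by move=> q _; rewrite /Dop rmorph_sum big_distrl.
rewrite (exchange_big_dep xpredT) //=; apply: eq_bigr => p _.
rewrite [in RHS]schurv2_rec -(rmorph_int (@polyC R)) /= coefCM coef_sum big_distrr /= big_mkcondr /=.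
apply: eq_bigr => q hs; rewrite Sx' // /x' ltnn coefMC coefXn.
have le := hstrip2_area hs.
have ->: (k == area2 p - area2 q)%N = (area2 p == area2 q + k)%N by apply/eqP/eqP; lia.
by case: eqP => _; rewrite ?mul1r // mul0r mulr0.
Qed.

Lemma Rel_lin (I : Type) (s : seq I) (P : pred I) (c : I -> int) (G : I -> V -> int) :
  (forall i, P i -> Rel (G i)) -> Rel (fun p => \sum_(i <- s | P i) c i * G i p).
Proof.
move=> rG R x n; under eq_bigr => p _ do rewrite rmorph_sum big_distrl /=.
rewrite exchange_big /= big1 // => i Pi.
rewrite -[RHS](mulr0 (c i)%:~R) -[in RHS](rG i Pi R x n) big_distrr /=.
by apply: eq_bigr => p _; rewrite rmorphM mulrA.
Qed.

(** Strip operators return families vanishing off pairs of partitions, so [Dop 0] can be the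
    identity only on such families. *)
Definition supported g := forall p, g p != 0 -> is_part2 p.

Lemma supported_E k g : supported (Eop k g).
Proof.
move=> q; apply: contraNT => nisp; rewrite /Eop big_pred0 // => p.
apply/negbTE/negP => /andP [/andP [/vstripP [h1 _] /vstripP [h2 _]] _].
by case/negP: nisp; apply/andP.
Qed.

Lemma supported_D k g : supported (Dop k g).
Proof.
move=> q; apply: contraNT => nisp; rewrite /Dop big_pred0 // => p.
apply/negbTE/negP => /andP [/andP [/hstrip_is_part /andP [_ h1] /hstrip_is_part /andP [_ h2]] _].
by case/negP: nisp; apply/andP.
Qed.

Lemma Dop0 g : supported g -> Dop 0 g =1 g.
Proof.
move=> supp q; case: (boolP (is_part2 q)) => ispq; last first.
  rewrite [RHS](_ : _ = 0); last by apply/eqP; apply: contraNT ispq; apply: supp.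
  by apply/eqP; apply: contraNT ispq; apply: supported_D.
rewrite /Dop (big_pred1 q) // => p; rewrite addn0; apply/andP/eqP => [|->]; last first.
  by case/andP: ispq => /is_partP h1 /is_partP h2; split=> //; apply/andP; split; apply/hstripP => i;
    rewrite leqnn ?h1 ?h2.
case: p q ispq => [p1 p2] [q1 q2] /= _ [/andP [/= h1 h2]].
have := hstrip_area h1; have := hstrip_area h2; rewrite /area2 /= => l2 l1 /eqP eqs.
move/hstripP: h1 => h1; move/hstripP: h2 => h2.
congr pair; apply: sub_area_eq => [i|]; [by case/andP: (h1 i) | by lia
  | by case/andP: (h2 i) | by lia].
Qed.

(** The identity [sum_i (-1)^i h_i e_(k-i) = 0] for the adjoint operators. Exchanging the sums
    leaves, for fixed [p] and [r], the sum of [strip_inversion2], and [0 < k] excludes [p = r]. *)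
Lemma alternating_DE k g : supported g -> (0 < k)%N ->
  forall r, \sum_(i < k.+1) (-1) ^+ i * Dop i (Eop (k - i) g) r = 0.
Proof.
move=> supp k0 r; rewrite /Dop /Eop.
under eq_bigr => i _.
  rewrite big_distrr /=; under eq_bigr => q _ do rewrite big_distrr /=.
  rewrite (exchange_big_dep xpredT) //=; over.
rewrite exchange_big /= big1 // => p _.
under eq_bigr => i _ do rewrite big_mkcond /=.
rewrite exchange_big /=.
have [->|gp] := eqVneq (g p) 0.
  rewrite big1 // => q _; rewrite big1 // => i _; case: ifP => // _; by rewrite mulr0.
pose F q : int := if (vstrip2 p q && hstrip2 q r) then (-1) ^+ (area2 q - area2 r) else 0.
transitivity (\sum_q (if (area2 p == area2 r + k)%N then g p else 0) * F q).
  apply: eq_bigr => q _; rewrite /F.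
  case: (boolP (vstrip2 p q)) => vs /=; last first.
    by rewrite big1 ?mulr0 // => i _; rewrite andbF.
  case: (boolP (hstrip2 q r)) => hs /=; last by rewrite big1 ?mulr0.
  have l1 := vstrip2_area vs; have l2 := hstrip2_area hs.
  case: eqP => eqs; last first.
    rewrite mul0r big1 // => i _; case: ifP => // /andP [/eqP e1 /eqP e2].
    by case: eqs; have := ltn_ord i; lia.
  (* For a given [q] only the index [i = area2 q - area2 r] contributes. *)
  have lti : (area2 q - area2 r < k.+1)%N by lia.
  rewrite (bigD1 (Ordinal lti)) //= big1 ?addr0 => [|i ne].
    by rewrite ifT 1?mulrC //; apply/andP; split; apply/eqP; lia.
  case: ifP => // /andP [/eqP e1 /eqP e2]; case/eqP: ne; apply: val_inj => /=; lia.
rewrite -big_distrr /= -big_mkcond /= strip_inversion2; last exact: supp.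
case: (p =P r) => [->|_]; last by rewrite mulr0.
by rewrite ifF ?mul0r //; apply/eqP; lia.
Qed.

(** By [alternating_DE], [Eop k g] is a signed sum of operators [Dop i.+1] applied to
    [Eop (k - i.+1) g], so induction on [k] reduces the claim to [Rel_D]. *)
Lemma Rel_E k g : supported g -> Rel g -> Rel (Eop k g).
Proof.
move=> supp rg; elim/ltn_ind: k => k IH.
have [->|k0] := posnP k.
  apply: Rel_ext rg => q; case: (boolP (is_part2 q)) => ispq; last first.
    rewrite [LHS](_ : _ = 0); last by apply/eqP; apply: contraNT ispq; apply: supp.
    by apply/esym/eqP; apply: contraNT ispq; apply: supported_E.
  rewrite /Eop (big_pred1 q) // => p; rewrite addn0; apply/andP/eqP => [|->]; last first.
    case/andP: ispq => h1 h2; split=> //; apply/andP; split; apply/vstripP; split=> // i;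
    by rewrite leqnn leq_pred.
  case: p q ispq => [p1 p2] [q1 q2] /= _ [/andP [/= h1 h2]].
  have := vstrip_area h1; have := vstrip_area h2; rewrite /area2 /= => l2 l1 /eqP eqs.
  move/vstripP: h1 => [_ h1]; move/vstripP: h2 => [_ h2].
  congr pair; apply: sub_area_eq => [i|]; [by case/andP: (h1 i) | by lia
    | by case/andP: (h2 i) | by lia].
apply: (@Rel_ext (fun q => \sum_(i < k) (- (-1) ^+ i.+1) * Dop i.+1 (Eop (k - i.+1) g) q)).
  move=> q; have := alternating_DE supp k0 q; rewrite big_ord_recl expr0 mul1r subn0.
  rewrite Dop0; last exact: supported_E.
  move/eqP; rewrite addr_eq0 => /eqP ->; rewrite -sumrN.
  by apply: eq_bigr => i _; rewrite mulNr.
apply: Rel_lin => i _; apply: Rel_D; apply: IH.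
by have := ltn_ord i; lia.
Qed.


Definition delta p q : int := (q == p)%:R.

(* [s_(p.1) s_(p.2) - s_(q.1) s_(q.2)] is a nonnegative combination of Schur
   functions. *)
Definition dominates p q := exists h,
  [/\ forall r, 0 <= h r, forall r, h r != 0 -> r.2 = shape0 N,
      supported h & Rel (fun r => delta p r - delta q r - h r)].

(** The prescribed total is the largest possible, so both strips are maximal ([leq_add_tight]). *)
Lemma Dop_delta p : is_part2 p ->
  Dop (part p.1 0 + part p.2 0) (delta p) =1
  delta (behead_shape p.1, behead_shape p.2).
Proof.
move=> /andP [is_part1 is_part2] q; rewrite /Dop /delta big_mkcond (bigD1 p) //= eqxx.
rewrite big1 ?addr0 => [|r /negbTE ->]; last by rewrite if_same.
suff ->: hstrip2 p q && (area2 p == area2 q + (part p.1 0 + part p.2 0))%N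
    = (q == (behead_shape p.1, behead_shape p.2)) by case: eqP.
apply/andP/eqP => [[/andP [h1 h2] /eqP eqs]|->].
  have [l1 e1] := hstrip_max h1; have [l2 e2] := hstrip_max h2.
  have [e3 e4] := leq_add_tight l1 l2 eqs.
  by rewrite [q]surjective_pairing; congr pair; apply/eqP; rewrite -?e1 -?e2.
split; first by apply/andP; split; apply: hstrip_behead.
by rewrite /area2 /= (area_behead p.1) (area_behead p.2) addnACA.
Qed.

Lemma Eop_delta p : is_part2 p ->
  Eop (nrows p.1 + nrows p.2) (delta p) =1 delta (pred_shape p.1, pred_shape p.2).
Proof.
move=> /andP [is_part1 is_part2] q; rewrite /Eop /delta big_mkcond (bigD1 p) //= eqxx.
rewrite big1 ?addr0 => [|r /negbTE ->]; last by rewrite if_same.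
suff ->: vstrip2 p q && (area2 p == area2 q + (nrows p.1 + nrows p.2))%N
    = (q == (pred_shape p.1, pred_shape p.2)) by case: eqP.
apply/andP/eqP => [[/andP [h1 h2] /eqP eqs]|->].
  have [l1 e1] := vstrip_max h1; have [l2 e2] := vstrip_max h2.
  have [e3 e4] := leq_add_tight l1 l2 eqs.
  by rewrite [q]surjective_pairing; congr pair; apply/eqP; rewrite -?e1 -?e2.
split; first by apply/andP; split; apply: vstrip_pred.
by rewrite /area2 /= (area_pred p.1) (area_pred p.2) addnACA.
Qed.

Lemma supported_delta p : is_part2 p -> supported (delta p).
Proof. by move=> ispp q; rewrite /delta; case: (q =P p) => [->|_] //; rewrite eqxx. Qed.

(** Equal totals of the first rows make one [k] maximal for both products, so a single [Dop k]
    beheads all four shapes. It keeps the remainder nonnegative and its second shape empty. *)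
Lemma dominates_behead p q : is_part2 p -> is_part2 q ->
  (part p.1 0 + part p.2 0 = part q.1 0 + part q.2 0)%N -> dominates p q ->
  dominates (behead_shape p.1, behead_shape p.2) (behead_shape q.1, behead_shape q.2).
Proof.
move=> ispp ispq eqk [h [h0 h2 supp rg]].
exists (Dop (part p.1 0 + part p.2 0) h); split.
- by move=> r; apply: sumr_ge0.
- move=> r; apply: contraNeq => ne; apply/eqP/big1 => s /andP [/andP [_ hs] _].
  apply/eqP; apply: contraNT ne => /h2 e2; rewrite e2 hstrip0 in hs; exact/eqP/eqP.
- exact: supported_D.
apply: Rel_ext (Rel_D (part p.1 0 + part p.2 0) rg) => r.
rewrite -(Dop_delta ispp) -(Dop_delta ispq) -eqk /Dop !sumrB.
by [].
Qed.

Lemma dominates_pred p q : is_part2 p -> is_part2 q ->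
  (nrows p.1 + nrows p.2 = nrows q.1 + nrows q.2)%N -> dominates p q ->
  dominates (pred_shape p.1, pred_shape p.2) (pred_shape q.1, pred_shape q.2).
Proof.
move=> ispp ispq eqk [h [h0 h2 supp rg]].
exists (Eop (nrows p.1 + nrows p.2) h); split.
- by move=> r; apply: sumr_ge0.
- move=> r; apply: contraNeq => ne; apply/eqP/big1 => s /andP [/andP [_ /vstripP [_ vs]] _].
  apply/eqP; apply: contraNT ne => /h2 e2; apply/eqP/part_inj => i.
  by move: (vs i); rewrite e2 part0; lia.
- exact: supported_E.
have supp_g : supported (fun r => delta p r - delta q r - h r).
  move=> r ne; apply: contraNT ne => nisp.
  have h_r : h r = 0 by apply/eqP; apply: contraNT nisp; apply: supp.
  have p_r : delta p r = 0 by apply/eqP; apply: contraNT nisp; apply: supported_delta.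
  have q_r : delta q r = 0 by apply/eqP; apply: contraNT nisp; apply: supported_delta.
  by rewrite h_r p_r q_r.
apply: Rel_ext (Rel_E (nrows p.1 + nrows p.2) supp_g rg) => r.
rewrite -(Eop_delta ispp) -(Eop_delta ispq) -eqk /Eop !sumrB.
by [].
Qed.

End Relations.

(** * The bialternant formula *)

Section Bialternant.

Variables (N : nat) (R : comNzRingType) (x : nat -> R).
Implicit Types (la ka : shape N).

Local Open Scope ring_scope.

Definition alt n (q : nat -> nat) : R := \det (\matrix_(j < n, i < n) x i ^+ q j).

(** The exponents [la + delta], where [delta = (n-1, ..., 0)]. *)
Definition shifted n la j := (part la j + (n - j.+1))%N.

Lemma area_trunc n la : (n <= N)%N -> is_part la -> part la n = 0%N ->
  area la = (\sum_(j < n) part la j)%N.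
Proof.
move=> leN is_part_la la0; rewrite /area (big_ord_widen _ (part la) leN).
rewrite [RHS]big_mkcond /=; apply: eq_bigr => i _; case: ltnP => // le.
by apply/eqP; rewrite -leqn0 -la0; apply: is_part_le.
Qed.

Lemma geometric_sum (a b : R) (c l u : nat) : (u <= N)%N -> (l <= u.+1)%N ->
  (a - b) * \sum_(t < N.+1 | (l <= t <= u)%N) a ^+ (t + c) * b ^+ (u - t)
  = a ^+ (u.+1 + c) - a ^+ (l + c) * b ^+ (u.+1 - l).
Proof.
move=> leuN lelu.
rewrite (eq_bigl (fun t : 'I_N.+1 => (l <= t) && (t < u.+1))%N) => [|t]; last by rewrite ltnS.
rewrite -(big_mkord (fun t => (l <= t) && (t < u.+1))%N (fun t => a ^+ (t + c) * b ^+ (u - t))).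
rewrite -(big_nat_widen 0 u.+1 N.+1 (fun t => l <= t)%N) // -(big_nat_widenl l 0%N _ xpredT) //.
rewrite big_distrr /= (telescope_sumr_eq (fun t => a ^+ (t + c) * b ^+ (u.+1 - t))) //.
  by rewrite subnn mulr1.
move=> t /andP [_ lt]; rewrite subSS addSn exprS (subSn (lt : (t <= u)%N)) exprS; ring.
Qed.

(** Interlacing constrains the rows of [ka] independently, so the product of sums expands over
    horizontal strips; [Q] forces the rows from [n] on to be empty. *)
Lemma prod_hstrip n la (F : nat -> nat -> R) : (n <= N)%N -> part la n.+1 = 0%N ->
  is_part la ->
  \prod_(j < n) \sum_(t < N.+1 | (part la j.+1 <= t <= part la j)%N) F j t
  = \sum_(ka | hstrip la ka && (part ka n == 0%N)) \prod_(j < n) F j (part ka j).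
Proof.
move=> leN la0 is_part_la.
pose Q (j : 'I_N) (t : 'I_N.+1) :=
  if (j < n)%N then (part la j.+1 <= t <= part la j)%N else t == 0%N :> nat.
rewrite (eq_big (fun ka => ka \in family Q)
    (fun ka : shape N => \prod_(j < N) (if (j < n)%N then F j (ka j) else 1))).
- rewrite -(bigA_distr_big_dep _ (fun (j : 'I_N) (t : 'I_N.+1) => if (j < n)%N then F j t else 1)) /=.
  rewrite (big_ord_widen _ (fun j =>
    \sum_(t < N.+1 | (part la j.+1 <= t <= part la j)%N) F j t) leN).
  rewrite big_mkcond /=; apply: eq_bigr => j _; rewrite /Q; case: ifP => // _.
  by rewrite (big_pred1 ord0).
- move=> ka; apply/andP/familyP => [[hs /eqP ka0] j|H].
    rewrite unfold_in /Q -part_ord; case: ltnP => le; first by move/hstripP: hs.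
    have [_ is_part_ka] := andP (hstrip_is_part hs).
    by rewrite -leqn0 -ka0; apply: is_part_le.
  have kaE j : (n <= j)%N -> part ka j = 0%N.
    move=> le; case: (ltnP j N) => ltj; last by rewrite part_default.
    by have := H (Ordinal ltj); rewrite unfold_in /Q ltnNge le /= -part_ord => /eqP.
  rewrite kaE //; split=> //; apply/hstripP => j.
  case: (ltnP j n) => lt.
    by have := H (Ordinal (leq_trans lt leN)); rewrite unfold_in /Q /= lt -part_ord.
  rewrite kaE //= andbT -la0; exact: is_part_le.
move=> ka _; rewrite (big_ord_widen _ (fun j => F j (part ka j)) leN) big_mkcond /=.
by apply: eq_bigr => j _; rewrite part_ord.
Qed.

(** Subtracting from each row a multiple of the next (the matrix [L]) clears the last column except
    for its bottom entry. In the remaining minor [geometric_sum] extracts [x i - x n] from column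
    [i] and leaves sums over exactly the interlacing ranges. *)
Lemma alt_branch n la : (n < N)%N -> is_part la -> part la n.+1 = 0%N ->
  alt n.+1 (shifted n.+1 la) = \prod_(i < n) (x i - x n) *
    \sum_(ka | hstrip la ka && (part ka n == 0%N))
       x n ^+ (area la - area ka) * alt n (shifted n ka).
Proof.
move=> ltN is_part_la la0; pose q := shifted n.+1 la.
have leq_q j : (j < n)%N -> (q j.+1 < q j)%N.
  by move=> ltj; rewrite /q /shifted; move/is_partP: is_part_la => /(_ j); lia.
pose M : 'M[R]_n.+1 := \matrix_(j, i) x i ^+ q j.
pose L : 'M[R]_n.+1 := \matrix_(j, k)
  if k == j then 1 else if k == j.+1 :> nat then - x n ^+ (q j - q j.+1) else 0.
have detL : \det L = 1.
  rewrite -det_tr det_trig; first by rewrite big1 // => i _; rewrite !mxE eqxx.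
  apply/is_trig_mxP => i j lt; rewrite !mxE -val_eqE /=.
  by rewrite !ifF //; apply/eqP; lia.
have LM j i : (L *m M) j i = if (j < n)%N then
    x i ^+ q j - x i ^+ q j.+1 * x n ^+ (q j - q j.+1) else x i ^+ q j.
  rewrite mxE (bigD1 j) //= !mxE eqxx mul1r; case: ltnP => ltj; last first.
    rewrite big1 ?addr0 // => k /negbTE ne; rewrite !mxE ne ifF ?mul0r //.
    by apply/eqP; have := ltn_ord k; lia.
  have ltj1 : (j.+1 < n.+1)%N by [].
  rewrite (bigD1 (Ordinal ltj1)) /=; last by rewrite -val_eqE /= gtn_eqF.
  rewrite big1 ?addr0 => [|k /andP [/negbTE ne1 ne2]].
    by rewrite !mxE eqxx -val_eqE /= gtn_eqF // mulNr mulrC.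
  by rewrite !mxE ne1 ifF ?mul0r //; apply: contraNF ne2 => /eqP e; apply/eqP/val_inj.
pose G : 'M[R]_n := \matrix_(j, i) \sum_(t < N.+1 | (part la j.+1 <= t <= part la j)%N)
   (x i ^+ (t + (n - j.+1)) * x n ^+ (part la j - t)).
have -> : alt n.+1 (shifted n.+1 la) = x n ^+ part la n * \det (row' ord_max (col' ord_max (L *m M))).
  rewrite /alt -/M -[LHS]mul1r -detL -det_mulmx (expand_det_col _ ord_max).
  rewrite (bigD1 ord_max) //= big1 ?addr0 => [|j ne]; last first.
    have ltj : (j < n)%N by have := ltn_ord j; move: ne; rewrite -val_eqE /=; lia.
    by rewrite LM ltj /= -exprD subnKC ?subrr ?mul0r // ltnW // leq_q.
  rewrite LM ltnn /= /cofactor -signr_odd oddD addbb mul1r.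
  by rewrite /q /shifted subnn addn0.
have -> : row' ord_max (col' ord_max (L *m M)) = G *m diag_mx (\row_i (x i - x n)).
  suff H (j i : 'I_n) : (L *m M) (lift ord_max j) (lift ord_max i) = G j i * (x i - x n).
    by apply/matrixP => j i; rewrite mul_mx_diag 2![LHS]mxE [RHS]mxE [X in _ * X]mxE; exact: H.
  rewrite LM lift_max ltn_ord !mxE lift_max [RHS]mulrC geometric_sum ?part_le //; last first.
    by apply: leqW; exact/is_partP.
  have ltj := ltn_ord j; have /is_partP/(_ j) lej := is_part_la.
  by congr (_ ^+ _ - _ ^+ _ * _ ^+ _); rewrite /q /shifted; lia.
rewrite det_mulmx det_diag mulrA mulrC; congr (_ * _).
  by apply: eq_bigr => i _; rewrite mxE.
(* [prod_hstrip] takes a family indexed by naturals, so the permutation is extended by the default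
   value 0. *)
pose s' (s : 'S_n) j : nat := oapp (fun j' : 'I_n => nat_of_ord (s j')) 0%N (insub j).
have detG : \det G = \sum_(s : 'S_n) (-1) ^+ s *
    \sum_(ka | hstrip la ka && (part ka n == 0%N))
      \prod_(j < n) (x (s j) ^+ shifted n ka j * x n ^+ (part la j - part ka j)).
  apply: eq_bigr => s _; congr (_ * _).
  transitivity (\prod_(j < n) \sum_(t < N.+1 | (part la j.+1 <= t <= part la j)%N)
      (x (s' s j) ^+ (t + (n - j.+1)) * x n ^+ (part la j - t))).
    by apply: eq_bigr => j _; rewrite mxE /s' valK.
  rewrite (prod_hstrip (fun j t => x (s' s j) ^+ (t + (n - j.+1)) * x n ^+ (part la j - t)))
    ?(ltnW ltN) //.
  by apply: eq_bigr => ka _; apply: eq_bigr => j _; rewrite /s' valK.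
rewrite detG; under eq_bigr => s _ do rewrite big_distrr /=.
rewrite exchange_big /= big_distrr /=; apply: eq_bigr => ka /andP [hs /eqP ka0].
have [_ is_part_ka] := andP (hstrip_is_part hs).
have -> : x n ^+ (area la - area ka) = x n ^+ part la n * \prod_(j < n) x n ^+ (part la j - part ka j).
  rewrite prodrXr -exprD (area_trunc ltN) // (area_trunc (ltnW ltN)) // big_ord_recr /=.
  rewrite sumnB => [|j _]; last by move/hstripP: hs => /(_ j) /andP [].
  rewrite addnC addnBA //; last by apply: leq_sum => j _; move/hstripP: hs => /(_ j) /andP [].
rewrite -mulrA; congr (_ * _); rewrite /alt /determinant big_distrr /=; apply: eq_bigr => s _.
rewrite mulrCA; congr (_ * _); rewrite big_split /= mulrC; congr (_ * _).
by apply: eq_bigr => j _; rewrite mxE.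
Qed.

(** [alt_branch] peels the same product of differences off both alternants, leaving the branching
    rule. The shapes with too many rows, absent from [alt_branch], vanish by [schurv_long]. *)
Lemma bialternant n la : (n <= N)%N -> is_part la -> part la n = 0%N ->
  alt n (shifted n (shape0 N)) * schurv n la x = alt n (shifted n la).
Proof.
elim: n la => [|n IH] la leN is_part_la la0 /=.
  have -> : la = shape0 N.
    apply: part_inj => i; apply/eqP; rewrite part0 -leqn0 -la0; exact: is_part_le.
  by rewrite eqxx mulr1.
rewrite !alt_branch ?part0 ?is_part0 // (big_pred1 (shape0 N)) => [|ka]; last first.
  by rewrite hstrip0 /=; case: (ka =P shape0 N) => [->|_] //; rewrite part0.
rewrite subnn expr0 mul1r -mulrA; congr (_ * _).
rewrite (bigID (fun ka => part ka n == 0%N)) /= [X in _ * (_ + X)]big1 ?addr0; last first.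
  by move=> ka /andP [_ ne]; rewrite schurv_long ?mulr0 // lt0n.
rewrite big_distrr; apply: eq_bigr => ka /andP [hs /eqP ka0] /=.
have [_ is_part_ka] := andP (hstrip_is_part hs).
by rewrite mulrCA IH // ltnW.
Qed.

End Bialternant.

(** * Coefficients of alternants *)

Section FixedPoints.

Variable n : nat.
Implicit Types s w : 'S_n.

Definition antitone (p : nat -> nat) := forall i j, i < j < n -> p j < p i.

Lemma antitone_lt p i j : antitone p -> i < n -> j < n -> p i < p j -> j < i.
Proof.
move=> dec lti ltj ltp; rewrite ltnNge; apply/negP; rewrite leq_eqVlt => /orP [/eqP e|lt].
  by rewrite e ltnn in ltp.
by have := dec i j; rewrite lt ltj => /(_ isT); lia.
Qed.

(** The least index that is moved would go to a smaller one, which is already fixed, against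
    injectivity. *)
Lemma fixed_below s m : (forall i : 'I_n, i < m -> s i <= i) ->
  forall i : 'I_n, i < m -> s i = i.
Proof.
move=> H i; move: {2}(nat_of_ord i) (leqnn i) => k.
elim/ltn_ind: k i => k IH i leik ltim; apply/eqP; rewrite -val_eqE /= eqn_leq H //=.
rewrite leqNgt; apply/negP => lt.
have e : s (s i) = s i by apply: (IH (s i)) => //; [apply: leq_trans lt leik | apply: ltn_trans lt ltim].
by rewrite (perm_inj e) ltnn in lt.
Qed.

Lemma fixed_above s m : (forall i : 'I_n, m <= i -> i <= s i) ->
  forall i : 'I_n, m <= i -> s i = i.
Proof.
move=> H i; move: {2}(n - i) (leqnn (n - i)) => k.
elim/ltn_ind: k i => k IH i leik ltim; apply/eqP; rewrite -val_eqE /= eqn_leq H // andbT.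
rewrite leqNgt; apply/negP => lt.
have e : s (s i) = s i.
  by apply: (IH (n - s i)) => //; [have := ltn_ord (s i); lia | apply: leq_trans ltim (ltnW lt)].
by rewrite (perm_inj e) ltnn in lt.
Qed.

(* The large values of [q] can only be matched with themselves, and then so
   can the small ones. *)
Lemma matching_fixed s (p q : nat -> nat) b c : antitone p -> antitone q ->
  (forall i, i < n -> ~~ (b <= i < c) -> p i = q i) ->
  (forall i : 'I_n, q (s i) <= p i) ->
  forall i : 'I_n, ~~ (b <= i < c) -> s i = i.
Proof.
move=> dp dq eqpq le i; rewrite negb_and -ltnNge -leqNgt => /orP [ltb|lec].
  suff e : (s^-1)%g i = i by rewrite -{1}e permKV.
  apply: (fixed_below (m := b)) ltb => l ltb; rewrite leqNgt; apply/negP => lt.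
  have := le ((s^-1)%g l); rewrite permKV -eqpq ?ltn_ord //; last by rewrite negb_and -ltnNge ltb.
  by have := dp l ((s^-1)%g l); rewrite lt ltn_ord => /(_ isT); lia.
apply: (fixed_above (m := c)) lec => l lec; rewrite leqNgt; apply/negP => lt.
have := le l; rewrite eqpq ?ltn_ord //; last by rewrite negb_and -[~~ (_ < c)]leqNgt lec orbT.
by have := dq (s l) l; rewrite lt ltn_ord => /(_ isT); lia.
Qed.

(** Matching two strictly decreasing sequences makes [s] increasing, hence [l <= s l], and
    [fixed_above] applies from 0. *)
Lemma antitone_perm1 s (p q : nat -> nat) : antitone p -> antitone q ->
  (forall i : 'I_n, q (s i) = p i) -> s = 1%g.
Proof.
move=> dp dq e; apply/permP => i; rewrite perm1.
have incr (u v : 'I_n) : u < v -> s u < s v.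
  move=> lt; apply: (antitone_lt dq) => //; rewrite !e; apply: dp; by rewrite lt ltn_ord.
apply: (fixed_above (m := 0)) => // l _; move: {2}(nat_of_ord l) (erefl (nat_of_ord l)) => k.
elim: k l => [|k IH] l el; first by rewrite el.
have ltk : k < n by have := ltn_ord l; lia.
have := IH (Ordinal ltk) erefl; have := incr (Ordinal ltk) l; rewrite el /= ltnSn => /(_ isT).
by lia.
Qed.

End FixedPoints.

Section Coefficients.

Variable n : nat.
Local Open Scope ring_scope.

Definition mvar i : {mpoly int[n]} := if insub i is Some i' then 'X_i' else 0.

Lemma mvar_ord (i : 'I_n) : mvar i = 'X_i.
Proof. by rewrite /mvar valK. Qed.

Definition mexp (p : nat -> nat) : 'X_{1..n} := [multinom p i | i < n].

Lemma altE q : alt mvar n q =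
  \sum_(s : 'S_n) (-1) ^+ s * 'X_[[multinom q (s i) | i < n]].
Proof.
rewrite /alt /determinant (reindex_inj invg_inj) /=; apply: eq_bigr => s _.
rewrite odd_permV; congr (_ * _); rewrite (mpolyXE _ (s^-1)%g).
by apply: eq_bigr => i _; rewrite mxE mvar_ord mnmE permKV.
Qed.

(** The coefficient of [x^(p - u)]; the test replaces truncated subtraction by the value 0 at
    negative exponents. *)
Definition shifted_coef (f : {mpoly int[n]}) (p u : 'I_n -> nat) : int :=
  if [forall i, u i <= p i]%N then f@_[multinom (p i - u i)%N | i < n] else 0.

Lemma mcoeffXM (f : {mpoly int[n]}) (p u : 'I_n -> nat) :
  ('X_[[multinom u i | i < n]] * f)@_[multinom p i | i < n] = shifted_coef f p u.
Proof.
rewrite mulrC /shifted_coef; case: forallP => [le|nle].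
  rewrite -(mcoeffMX f [multinom u i | i < n]); congr (_@__).
  by apply/mnmP => i; rewrite mnmDE !mnmE subnKC.
apply/eqP; rewrite mcoeff_eq0 (perm_mem (msuppMX _ _)); apply/negP => /mapP [m _ e].
by case: nle => i; have := congr1 (fun m : 'X_{1..n} => m i) e; rewrite mnmDE !mnmE => ->; rewrite leq_addr.
Qed.

Lemma mcoeff_altM q (f : {mpoly int[n]}) (p : 'I_n -> nat) :
  (alt mvar n q * f)@_[multinom p i | i < n] =
  \sum_(s : 'S_n) (-1) ^+ s * shifted_coef f p (fun i => q (s i)).
Proof.
rewrite altE big_distrl raddf_sum /=; apply: eq_bigr => s _.
by rewrite -mulrA; case: (odd_perm s); rewrite ?expr1 ?expr0 ?mulN1r ?mul1r ?raddfN /= mcoeffXM.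
Qed.

Lemma mcoeff_alt q p : antitone n p -> antitone n q ->
  (alt mvar n q)@_(mexp p) = [forall i : 'I_n, q i == p i]%:R.
Proof.
move=> dp dq; rewrite altE raddf_sum /= (bigD1 1%g) //= big1 ?addr0 => [|s ne].
  rewrite odd_perm1 expr0 mul1r mcoeffX; congr (nat_of_bool _)%:R.
  apply/eqP/forallP => [e i|H]; last by apply/mnmP => i; rewrite !mnmE perm1 (eqP (H i)).
  by have := congr1 (fun m : 'X_{1..n} => m i) e; rewrite !mnmE perm1 => ->.
have -> : ((-1) ^+ s * 'X_[[multinom q (s i) | i < n]])@_(mexp p) =
  (-1) ^+ s * ('X_[[multinom q (s i) | i < n]])@_(mexp p) :> int.
  by case: (odd_perm s); rewrite ?expr1 ?expr0 ?mulN1r ?mul1r ?raddfN.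
rewrite mcoeffX; case: eqP => [e|_]; last by rewrite mulr0.
case/eqP: ne; apply: (antitone_perm1 dp dq) => i.
by have := congr1 (fun m : 'X_{1..n} => m i) e; rewrite !mnmE.
Qed.

Lemma antitone_shifted N (la : shape N) : is_part la -> antitone n (shifted n la).
Proof.
by move=> is_part_la i j /andP [lt ltn]; have := is_part_le is_part_la (ltnW lt); rewrite /shifted; lia.
Qed.

Lemma msym_alt (s : 'S_n) q : msym s (alt mvar n q) = (-1) ^+ s * alt mvar n q.
Proof.
rewrite altE raddf_sum /= (reindex_inj (mulgI s)) /= big_distrr; apply: eq_bigr => t _ /=.
rewrite msymM rmorphXn rmorphN1 /= msymX odd_permM signr_addb -mulrA; congr (_ * (_ * 'X_[_])).
by apply/mnmP => i; rewrite !mnmE permM permKV.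
Qed.

(** [a_delta] and [a_delta s_la] change by the same sign, and [a_delta], nonzero by its coefficient
    at [delta], can be cancelled. *)
Lemma schurv_sym N (la : shape N) (s : 'S_n) : (n <= N)%N -> is_part la -> part la n = 0%N ->
  msym s (schurv n la mvar) = schurv n la mvar.
Proof.
move=> leN is_part_la la0; have eq_alt := bialternant mvar leN is_part_la la0.
set a0 := alt mvar n _ in eq_alt; set a := alt mvar n _ in eq_alt.
have eq_sym : a0 * msym s (schurv n la mvar) = a0 * schurv n la mvar.
  apply: (inv_inj (signrMK s)) => /=.
  by rewrite eq_alt -[RHS]msym_alt -/a -eq_alt msymM [msym s a0]msym_alt mulrA.
suff nz0 : a0 != 0 by exact: (mulfI nz0 eq_sym).
apply/eqP => alt0.
have ant0 := antitone_shifted (is_part0 N).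
have := mcoeff_alt ant0 ant0; rewrite -/a0 alt0 mcoeff0.
by have -> : [forall i : 'I_n, shifted n (shape0 N) i == shifted n (shape0 N) i] by apply/forallP.
Qed.

End Coefficients.

(** * Translation invariance of skew coefficients *)

Section SkewTranslate.

Variables (n a d j M : nat) (lam eta sig : nat -> nat) (f : {mpoly int[n]}).

Hypothesis ad_le : a + d <= n.
Hypothesis lam_dec : forall i, lam i.+1 <= lam i.
Hypothesis eta_dec : forall i, eta i.+1 <= eta i.
Hypothesis sig_dec : forall i, sig i.+1 <= sig i.
Hypothesis lam_le : forall i, lam i <= M.
Hypothesis lam_above : forall i, i < a -> lam i = eta i.
Hypothesis lam_window : forall k, lam (a + k) = eta (a + k) + sig k.
Hypothesis eta_window : forall k, k < d -> eta (a + k) = j.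
Hypothesis sig_below : forall k, d <= k -> sig k = 0.

Local Open Scope ring_scope.

Hypothesis f_sym : forall (s : 'S_n) (m : 'X_{1..n}), f@_[multinom m (s i) | i < n] = f@_m.

(** The exponents [th + delta] for the complement [th] of [e] in [n] rows of length [M]. *)
Let co_shift (e : nat -> nat) i := (M - e (n - i.+1) + (n - i.+1))%N.

Let dec_le (e : nat -> nat) : (forall i, e i.+1 <= e i)%N ->
  forall u v, (u <= v)%N -> (e v <= e u)%N.
Proof.
move=> dec u v /subnK <-; elim: (v - u)%N => // k IH.
exact: leq_trans (dec _) IH.
Qed.

Let antitone_co (e : nat -> nat) : (forall i, e i.+1 <= e i)%N -> antitone n (co_shift e).
Proof.
move=> dec u v /andP [lt ltn]; rewrite /co_shift.
have : (e (n - u.+1) <= e (n - v.+1))%N by apply: dec_le => //; lia.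
lia.
Qed.

(** Sends row [k < d] of the window to the index of row [a + k] in the reversed order of the
    complement; the cyclic shift extends this to a permutation of all indices. *)
Let rho_fun (k : 'I_n) : 'I_n := rev_ord (Ordinal (ltn_pmod (k + a) (leq_ltn_trans (leq0n k) (ltn_ord k)))).

Let rho_inj : injective rho_fun.
Proof.
move=> k l /rev_ord_inj /(congr1 val) /= /eqP.
by rewrite eqn_modDr !modn_small // => /eqP /val_inj.
Qed.

Let rho : 'S_n := perm rho_inj.

Let rho_low (k : 'I_n) : (k < d)%N -> rho k = (n - (a + k).+1)%N :> nat.
Proof.
move=> ltk; rewrite permE /= modn_small; first by rewrite addnC.
by apply: leq_trans ad_le; rewrite addnC ltn_add2l.
Qed.

Let rho_high (k : 'I_n) : (d <= k)%N -> ~~ (n - (a + d) <= rho k < n - a)%N.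
Proof.
move=> lek; rewrite permE /=; have ltk := ltn_ord k.
case: (ltnP (k + a) n) => lt; first by rewrite modn_small //; lia.
rewrite -(subnK lt) modnDr modn_small; lia.
Qed.

(* The coefficient of the Schur function of the complement of [eta] in the
   product of [f] with the Schur function of the complement of [lam] depends
   only on the shape of [lam/eta]: all but the [d] rows of the window are forced
   to be fixed points of the permutations that contribute, on both sides. *)
Lemma skew_translate :
  \sum_(s : 'S_n) (-1) ^+ s * shifted_coef f (co_shift eta) (fun i => co_shift lam (s i))
  = \sum_(s : 'S_n) (-1) ^+ s *
      shifted_coef f (fun i => sig i + (n - i.+1))%N (fun i => n - (s i).+1)%N.
Proof.
(* Complementing changes the sign of the exponents: the index of [eta] becomes [w k] and that of
   [lam] becomes [k], hence the inverse. *)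
pose conj (w : 'S_n) : 'S_n := (w^-1 ^ rho)%g.
have conj_inj : injective conj by move=> u v /conjg_inj /invg_inj.
rewrite (reindex_inj conj_inj) /=; apply: eq_bigr => w _.
have -> : odd_perm (conj w) = odd_perm w.
  by rewrite /conj /conjg !odd_permM !odd_permV addbC addbK.
congr (_ * _).
have conjE (k : 'I_n) : conj w (rho k) = rho ((w^-1)%g k) by rewrite /conj /conjg !permM permK.
have off i : (i < n)%N -> ~~ (n - (a + d) <= i < n - a)%N -> co_shift eta i = co_shift lam i.
  move=> lti out; rewrite /co_shift; congr (_ - _ + _)%N; apply/esym.
  case: (ltnP (n - i.+1) a) => [/lam_above //|lea].
  by rewrite -(subnKC lea) lam_window sig_below ?addn0 //; lia.
have valid1 : [forall i, co_shift lam (conj w i) <= co_shift eta i]%N ->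
    forall k : 'I_n, (d <= k)%N -> w k = k.
  move=> /forallP le k lek.
  have := matching_fixed (antitone_co eta_dec) (antitone_co lam_dec) off le (rho_high lek).
  by rewrite conjE => /perm_inj e; rewrite -{1}e permKV.
have valid2 : [forall i : 'I_n, n - (w i).+1 <= sig i + (n - i.+1)]%N ->
    forall k : 'I_n, (d <= k)%N -> w k = k.
  move=> /forallP le k lek.
  apply: (matching_fixed (p := fun i => (sig i + (n - i.+1))%N) (q := fun i => (n - i.+1)%N)
     (b := 0) (c := d)) => //.
  - by move=> u v /andP [lt ltn]; have := dec_le sig_dec (ltnW lt); lia.
  - by move=> u v /andP [lt ltn]; lia.
  - by move=> i _ out; rewrite sig_below //; lia.
  by rewrite -leqNgt.
case: (boolP [forall k : 'I_n, (d <= k)%N ==> (w k == k)]) => [/forallP fixw|nfix]; last first.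
  have nvalid : ~ (forall k : 'I_n, (d <= k)%N -> w k = k).
    move=> H; case/negP: nfix; apply/forallP => k; apply/implyP => /H ->; exact: eqxx.
  rewrite /shifted_coef ifF; last by apply/negP => /valid1.
  by rewrite ifF //; apply/negP => /valid2.
have {}fixw (k : 'I_n) : (d <= k)%N -> w k = k by move=> lek; have := fixw k; rewrite lek => /eqP.
have w_low (k : 'I_n) : (k < d)%N -> (w k < d)%N.
  move=> ltk; rewrite ltnNge; apply/negP => le.
  by have /perm_inj e := fixw _ le; rewrite e leqNgt ltk in le.
have key (k : 'I_n) : [/\ (co_shift lam (conj w (rho (w k))) <= co_shift eta (rho (w k)))%N
      = (n - (w k).+1 <= sig k + (n - k.+1))%N &
    (co_shift eta (rho (w k)) - co_shift lam (conj w (rho (w k))))%N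
      = (sig k + (n - k.+1) - (n - (w k).+1))%N].
  rewrite conjE permK; case: (ltnP k d) => ltk; last first.
    rewrite fixw // off ?ltn_ord //; last exact: rho_high.
    by rewrite sig_below // add0n !leqnn !subnn.
  have ltwk := w_low k ltk.
  rewrite /co_shift !rho_low //.
  have subE u : (u < d)%N -> (n - (n - (a + u).+1).+1 = a + u)%N by lia.
  rewrite !subE // lam_window !eta_window //.
  have := lam_le (a + k); rewrite lam_window eta_window //.
  by have := ltn_ord k; have := ltn_ord (w k); lia.
rewrite /shifted_coef.
have -> : [forall i, co_shift lam (conj w i) <= co_shift eta i]%N
    = [forall i : 'I_n, n - (w i).+1 <= sig i + (n - i.+1)]%N.
  apply/forallP/forallP => H k; first by case: (key k) => <- _; exact: H.
  have := H ((w^-1)%g ((rho^-1)%g k)).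
  by case: (key ((w^-1)%g ((rho^-1)%g k))) => <- _; rewrite !permKV.
case: ifP => // _.
(* The two exponent vectors are rearrangements of each other, so the symmetry of [f] identifies the
   coefficients. *)
rewrite -(f_sym (w * rho)%g); congr (_@__); apply/mnmP => k; rewrite !mnmE permM.
by case: (key k).
Qed.

End SkewTranslate.

(** * Partitions as sequences *)

Lemma nth_geq (la : seq nat) : sorted geq la -> forall i j, i <= j -> nth 0 la j <= nth 0 la i.
Proof.
move=> sorted_la i j leij; case: (ltnP j (size la)) => ltj; last by rewrite nth_default.
have tr : transitive geq by move=> ? ? ? /[swap]; apply: leq_trans.
by apply: (sorted_leq_nth tr leqnn 0 sorted_la) => //; rewrite inE ?ltj // (leq_ltn_trans leij).
Qed.

Lemma ltn_nth_conjugate (la : seq nat) : sorted geq la ->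
  forall i x, (x < nth 0 (conjugate la) i) = (i < nth 0 la x).
Proof.
move=> sorted_la i x; have mono := nth_geq sorted_la; rewrite /conjugate.
case: (ltnP i (head 0 la)) => lti; last first.
  rewrite nth_default ?size_mkseq // ltn0; apply/esym/negbTE; rewrite -leqNgt.
  by apply: leq_trans lti; rewrite -nth0; exact: mono.
rewrite nth_mkseq // -{1}(mkseq_nth 0 la) /mkseq count_map.
rewrite count_downset /=; last by move=> u v leuv /leq_trans -> //; exact: mono.
by case: ltnP => // le; rewrite nth_default.
Qed.

Lemma nth_conjugate_le (la : seq nat) i : nth 0 (conjugate la) i <= size la.
Proof.
case: (ltnP i (head 0 la)) => lti; last by rewrite nth_default ?size_mkseq.
by rewrite nth_mkseq // count_size.
Qed.

Lemma sorted_nth (la : seq nat) : (forall i, nth 0 la i.+1 <= nth 0 la i) -> sorted geq la.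
Proof. by move=> H; apply/(sortedP 0) => i _; exact: H. Qed.

Lemma sorted_conjugate (la : seq nat) : sorted geq la -> sorted geq (conjugate la).
Proof.
move=> sorted_la; apply: sorted_nth => i; rewrite leqNgt; apply/negP.
by rewrite ltn_nth_conjugate // => /ltnW; rewrite -ltn_nth_conjugate // ltnn.
Qed.

Lemma nth_filter_neq0 (s : seq nat) : sorted geq s ->
  forall i, nth 0 [seq x <- s | x != 0] i = nth 0 s i.
Proof.
elim: s => //= x s IH sorted_s i; have sorted_s' := path_sorted sorted_s.
case: x sorted_s => [|x] sorted_s /=; last by case: i => //= i; rewrite IH.
have s0 j : nth 0 s j = 0.
  by have := @nth_geq (0 :: s) sorted_s 0 j.+1 (leq0n _); rewrite leqn0 => /eqP.
by rewrite IH // s0; case: i => //= i; rewrite s0.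
Qed.

Section Complement.

Variables (m : nat) (mu : seq nat).
Hypothesis sorted_mu : sorted geq mu.

Let co := mkseq (fun i => m - nth 0 mu (m - i.+1)) m.

Let sorted_co : sorted geq co.
Proof.
apply: sorted_nth => i; case: (ltnP i.+1 m) => lt; last by rewrite nth_default ?size_mkseq.
by rewrite !nth_mkseq ?(ltnW lt) // leq_sub2l // nth_geq // leq_sub2l.
Qed.

Lemma nth_complement i :
  nth 0 (complement m mu) i = if i < m then m - nth 0 mu (m - i.+1) else 0.
Proof.
rewrite /complement nth_filter_neq0 //; case: ifP => lt; first by rewrite nth_mkseq.
by rewrite nth_default // size_mkseq leqNgt lt.
Qed.

Lemma sorted_complement : sorted geq (complement m mu).
Proof. by apply: sorted_filter sorted_co => ? ? ? /[swap]; apply: leq_trans. Qed.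

Lemma size_complement : size (complement m mu) <= m.
Proof. by rewrite size_filter (leq_trans (count_size _ _)) // size_mkseq. Qed.

End Complement.

Lemma sumn_nth (la : seq nat) B : size la <= B -> sumn la = \sum_(i < B) nth 0 la i.
Proof.
move=> leB; rewrite sumnE (big_nth 0) big_mkord (big_ord_widen _ (nth 0 la) leB).
rewrite big_mkcond; apply: eq_bigr => i _; case: ltnP => // le; by rewrite nth_default.
Qed.

(** Some entry grows because the sum does, and this uses up the whole increase. *)
Lemma added_box (nu mu : seq nat) : sumn mu = (sumn nu).+1 -> part_incl nu mu ->
  exists k, forall i, nth 0 mu i = nth 0 nu i + (i == k).
Proof.
move=> eq_sum incl; pose B := size mu + size nu.
have eq_sums : \sum_(i < B) nth 0 mu i = (\sum_(i < B) nth 0 nu i).+1.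
  by rewrite -!sumn_nth ?leq_addl ?leq_addr.
have [k lt] : exists k : 'I_B, nth 0 nu k < nth 0 mu k.
  apply/existsP; rewrite -[[exists _, _]]negbK negb_exists; apply/negP => /forallP le.
  have : \sum_(i < B) nth 0 mu i <= \sum_(i < B) nth 0 nu i.
    by apply: leq_sum => i _; rewrite leqNgt le.
  by rewrite eq_sums ltnn.
exists (nat_of_ord k); rewrite (bigD1 k) //= [in RHS](bigD1 k) //= in eq_sums.
have le_sum : \sum_(i < B | i != k) nth 0 nu i <= \sum_(i < B | i != k) nth 0 mu i by exact: leq_sum.
have aux u v s t : u + s = (v + t).+1 -> v < u -> t <= s -> u = v + 1 /\ s = t by lia.
have [eq_k eq_rest] := aux _ _ _ _ eq_sums lt le_sum.
move=> i; case: (eqVneq i k) => [->|ne]; first exact: eq_k.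
rewrite addn0; case: (ltnP i B) => ltiB; last first.
  by rewrite !nth_default //; apply: leq_trans ltiB; rewrite ?leq_addl ?leq_addr.
have nei : Ordinal ltiB != k by [].
apply/eqP; rewrite eqn_leq incl andbT leqNgt; apply/negP => lti.
suff : \sum_(i < B | i != k) nth 0 nu i < \sum_(i < B | i != k) nth 0 mu i.
  by rewrite eq_rest ltnn.
rewrite (bigD1 (Ordinal ltiB)) //= [X in _ < X](bigD1 (Ordinal ltiB)) //= -addSn.
by apply: leq_add => //; apply: leq_sum.
Qed.

Lemma nth_inj_pos (la ka : seq nat) : 0 \notin la -> 0 \notin ka ->
  (forall i, nth 0 la i = nth 0 ka i) -> la = ka.
Proof.
move=> la0 ka0 eq; have pos (s : seq nat) i : 0 \notin s -> (i < size s) = (0 < nth 0 s i).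
  move=> s0; case: ltnP => lt; last by rewrite nth_default.
  by rewrite lt0n; apply/esym; apply: contraNneq s0 => <-; exact: mem_nth.
apply: (@eq_from_nth _ 0) => [|i _]; last exact: eq.
have le (s t : seq nat) : 0 \notin s -> 0 \notin t -> (forall i, nth 0 s i = nth 0 t i) ->
    size s <= size t.
  by move=> s0 t0 e; rewrite leqNgt; apply/negP; rewrite pos // e -pos // ltnn.
by apply/eqP; rewrite eqn_leq !le.
Qed.

Lemma nth_add_box_row1 nu i : nth 0 (add_box_row1 nu) i = nth 0 nu i + (i == 0).
Proof. by case: nu i => [|x nu] [|i] //=; rewrite ?addn1 ?addn0 ?nth_nil. Qed.

(** * From Schur polynomials to relations and coefficients *)

Section SchurEvaluation.

Local Open Scope ring_scope.

(** Transports an identity of integer polynomials to arbitrary values in any ring, as [Rel]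
    requires. *)
Definition int_eval n (R : comNzRingType) (x : nat -> R) : {rmorphism {mpoly int[n]} -> R} :=
  (meval (fun i : 'I_n => x i) \o map_mpoly intr)%FUN.

Lemma schur_eval N (R : comNzRingType) (x : nat -> R) n (la : seq nat) :
  sorted geq la -> (size la <= N)%N -> (head 0%N la <= N)%N ->
  int_eval n.+1 x (schur la n.+1) = schurv n.+1 (mkshape N (nth 0%N la)) x.
Proof.
move=> sorted_la size_la head_la; rewrite -box_sum // /schur (rmorph_sum (int_eval n.+1 x)).
apply: eq_bigr => T _; rewrite (rmorph_prod (int_eval n.+1 x)); apply: eq_bigr => p _ /=.
by rewrite map_mpolyX mevalXU.
Qed.

Lemma int_evalZ n (R : comNzRingType) (x : nat -> R) (c : int) p :
  int_eval n x (c *: p) = c%:~R * int_eval n x p.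
Proof. by rewrite /= map_mpolyZ mevalZ. Qed.

End SchurEvaluation.

Section Assembly.

Local Open Scope ring_scope.

Lemma sum_delta N (R : comNzRingType) (p : shape N * shape N) (F : shape N * shape N -> R) :
  \sum_q (delta p q)%:~R * F q = F p.
Proof.
rewrite (bigD1 p) //= /delta eqxx mul1r big1 ?addr0 // => q /negbTE ->.
by rewrite mul0r.
Qed.

Lemma schur_positive_dominates (al be ga de : seq nat) (B : nat) :
  (forall la, la \in [:: al; be; ga; de] ->
     [/\ sorted geq la, (size la <= B)%N & (head 0%N la <= B)%N]) ->
  schur_positive (fun n => schur al n * schur be n - schur ga n * schur de n) ->
  exists N, (B <= N)%N /\
    dominates (mkshape N (nth 0%N al), mkshape N (nth 0%N be))
              (mkshape N (nth 0%N ga), mkshape N (nth 0%N de)).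
Proof.
move=> bound [r [c [uniq_r c_ge0 eq_schur]]].
(* Large enough for the four given partitions and for all those in the finite expansion. *)
pose N := (B + \sum_(la <- r) (size la + head 0 la))%N.
have leB : (B <= N)%N by rewrite leq_addr.
exists N; split=> //.
have bound_r la : la \in r -> (size la <= N)%N /\ (head 0%N la <= N)%N.
  move=> la_r; have : (size la + head 0 la <= N)%N.
    apply: leq_trans (leq_addl _ _); rewrite (bigD1_seq la) //=; exact: leq_addr.
  by lia.
(* A single Schur function is encoded as a product with that of the empty shape, which is 1. *)
pose pair (la : seq nat) := (mkshape N (nth 0%N la), shape0 N).
have sorted_r la : la \in r -> sorted geq la by move=> /c_ge0 [/andP []].
have is_part_nth la : sorted geq la -> (size la <= N)%N -> (head 0%N la <= N)%N ->
    is_part (mkshape N (nth 0%N la)).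
  move=> sorted_la size_la head_la; have mono := nth_geq sorted_la.
  have E i : part (mkshape N (nth 0%N la)) i = nth 0%N la i.
    apply: part_mkshapeE => k; last by move=> lek; rewrite nth_default // (leq_trans size_la).
    by apply: leq_trans head_la; rewrite -nth0; exact: mono.
  by apply/is_partP => i; rewrite !E mono.
exists (fun q => \sum_(la <- r) c la * delta (pair la) q); split.
- move=> q; rewrite big_seq; apply: sumr_ge0 => la la_r.
  by apply: mulr_ge0; [case: (c_ge0 la la_r) | rewrite /delta ler0n].
- move=> q; apply: contraNeq => ne; rewrite big1 // => la _; rewrite /delta.
  by case: (q =P pair la) => [e|_]; rewrite ?mulr0 //; rewrite e eqxx in ne.
- move=> q; apply: contraNT => nisp; rewrite big_seq big1 // => la la_r; rewrite /delta.
  case: (q =P pair la) => [e|_]; rewrite ?mulr0 //; case/negP: nisp.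
  rewrite e /is_part2 is_part0 andbT; have [h1 h2] := bound_r la la_r.
  by apply: is_part_nth; rewrite ?sorted_r.
move=> R x n; have := congr1 (int_eval n.+1 x) (eq_schur n.+1).
have ev la : la \in [:: al; be; ga; de] ->
    int_eval n.+1 x (schur la n.+1) = schurv n.+1 (mkshape N (nth 0%N la)) x.
  by move=> /bound [h1 h2 h3]; apply: schur_eval => //; apply: leq_trans leB.
rewrite (rmorphB (int_eval n.+1 x)) !(rmorphM (int_eval n.+1 x)).
rewrite !ev ?inE ?eqxx ?orbT // (rmorph_sum (int_eval n.+1 x)) => eq.
under eq_bigr => q _ do rewrite !rmorphB /= !mulrBl.
rewrite !sumrB !sum_delta; apply/eqP; rewrite subr_eq0; apply/eqP.
rewrite [LHS]eq.
under [RHS]eq_bigr => q _ do rewrite rmorph_sum big_distrl /=.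
rewrite [RHS]exchange_big; apply: eq_big_seq => la la_r.
have [h1 h2] := bound_r la la_r.
rewrite int_evalZ (schur_eval x n (sorted_r la la_r) h1 h2).
under [RHS]eq_bigr => q _ do rewrite rmorphM -mulrA.
by rewrite -big_distrr sum_delta /schurv2 schurv_shape0 mulr1.
Qed.

Section Iterate.

Variable N : nat.
Implicit Types (la : shape N) (p q : shape N * shape N).

Lemma part_iter_behead t la i : part (iter t (@behead_shape N) la) i = part la (i + t).
Proof. by elim: t i => [|t IH] i; rewrite ?addn0 //= part_behead IH addnS. Qed.

Lemma part_iter_pred t la i : part (iter t (@pred_shape N) la) i = (part la i - t)%N.
Proof. by elim: t => [|t IH]; rewrite ?subn0 //= part_pred IH subnS. Qed.

Lemma is_part_iter_behead t la : is_part la -> is_part (iter t (@behead_shape N) la).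
Proof. by move=> is_part_la; elim: t => //= t; apply: is_part_behead. Qed.

Lemma is_part_iter_pred t la : is_part la -> is_part (iter t (@pred_shape N) la).
Proof. by move=> is_part_la; elim: t => //= t; apply: is_part_pred. Qed.

Lemma dominates_iter_behead t p q : is_part2 p -> is_part2 q ->
  (forall u, (u < t)%N -> (part p.1 u + part p.2 u = part q.1 u + part q.2 u)%N) ->
  dominates p q ->
  dominates (iter t (@behead_shape N) p.1, iter t (@behead_shape N) p.2)
            (iter t (@behead_shape N) q.1, iter t (@behead_shape N) q.2).
Proof.
move=> /andP [ip1 ip2] /andP [iq1 iq2] eqt dom.
elim: t eqt => [|t IH] eqt; first by case: p q dom {ip1 ip2 iq1 iq2 eqt} => ? ? [].
apply: (@dominates_behead N (_, _) (_, _)) => /=.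
- by rewrite /is_part2 /= !is_part_iter_behead.
- by rewrite /is_part2 /= !is_part_iter_behead.
- by rewrite !part_iter_behead eqt.
by apply: IH => u lt; apply: eqt; apply: ltnW.
Qed.

Lemma dominates_iter_pred t p q : is_part2 p -> is_part2 q ->
  (forall u, (u < t)%N -> forall i, (u < part p.1 i)%N = (u < part q.1 i)%N /\
     (u < part p.2 i)%N = (u < part q.2 i)%N) ->
  dominates p q ->
  dominates (iter t (@pred_shape N) p.1, iter t (@pred_shape N) p.2)
            (iter t (@pred_shape N) q.1, iter t (@pred_shape N) q.2).
Proof.
move=> /andP [ip1 ip2] /andP [iq1 iq2] eqt dom.
elim: t eqt => [|t IH] eqt; first by case: p q dom {ip1 ip2 iq1 iq2 eqt} => ? ? [].
apply: (@dominates_pred N (_, _) (_, _)) => /=.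
- by rewrite /is_part2 /= !is_part_iter_pred.
- by rewrite /is_part2 /= !is_part_iter_pred.
- by congr (_ + _)%N; apply: eq_bigr => i _; rewrite !part_iter_pred !subn_gt0;
    case: (eqt t (ltnSn t) i) => e1 e2; rewrite ?e1 ?e2.
by apply: IH => u lt; apply: eqt; apply: ltnW.
Qed.

(* The coefficient of x^(th + delta) in a_delta s_(p.1) s_(p.2) is the coefficient
   of s_th in the product. *)
Definition product_coef n (th : shape N) p : int :=
  (alt (@mvar n) n (shifted n (shape0 N)) * schurv2 n p (@mvar n))@_(mexp n (shifted n th)).

(** The remainder is a nonnegative combination of single Schur functions, each with coefficient 0 or
    1 at [th] by [bialternant] and [mcoeff_alt]. *)
Lemma dominates_coef n p q (th : shape N) : (n < N)%N -> is_part th -> dominates p q ->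
  product_coef n.+1 th q <= product_coef n.+1 th p.
Proof.
move=> leN is_part_th [h [h_ge0 h_row supp rel]]; set coef := product_coef n.+1 th.
have := rel _ (@mvar n.+1) n.
under eq_bigr => r _ do rewrite !rmorphB /= !mulrBl.
rewrite !sumrB !sum_delta => eq0.
have {eq0} eq : coef p - coef q = \sum_r h r * coef r.
  rewrite /coef /product_coef -mcoeffB -mulrBr -[X in (_ * X)@__](subrK (\sum_r (h r)%:~R * schurv2 n.+1 r (@mvar n.+1))).
  rewrite eq0 add0r big_distrr raddf_sum; apply: eq_bigr => r _ /=.
  by rewrite mulrCA -(rmorph_int (@mpolyC n.+1 int)) mcoeffCM intz.
rewrite -subr_ge0 eq; apply: sumr_ge0 => r _.
have [->|hr] := eqVneq (h r) 0; first by rewrite mul0r.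
apply: mulr_ge0 => //; rewrite /coef /product_coef /schurv2 (h_row r hr) schurv_shape0 mulr1.
have /andP [is_part_r _] := supp r hr.
have [r0|rpos] := posnP (part r.1 n.+1); last by rewrite schurv_long // mulr0 mcoeff0.
rewrite bialternant // mcoeff_alt ?ler0n //; exact: antitone_shifted.
Qed.

End Iterate.

(** [a_delta] is absorbed into the complement [be], while [s_al] is the symmetric [f] of
    [skew_translate]. After the translation the sum is the coefficient of [a_delta s_al] at
    [sig + delta], which compares [al] with [sig]. *)
Lemma coef_complement N (al be th : shape N) n a d j M (lam eta sig : nat -> nat) :
  (n <= N)%N -> is_part al -> part al n = 0%N -> is_part be -> part be n = 0%N ->
  (a + d <= n)%N ->
  (forall i, lam i.+1 <= lam i)%N -> (forall i, eta i.+1 <= eta i)%N ->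
  (forall i, sig i.+1 <= sig i)%N -> (forall i, lam i <= M)%N ->
  (forall i, (i < a)%N -> lam i = eta i) ->
  (forall k, lam (a + k)%N = (eta (a + k) + sig k)%N) ->
  (forall k, (k < d)%N -> eta (a + k)%N = j) ->
  (forall k, (d <= k)%N -> sig k = 0%N) ->
  (forall i, (i < n)%N -> part be i = (M - lam (n - i.+1))%N) ->
  (forall i, (i < n)%N -> part th i = (M - eta (n - i.+1))%N) ->
  product_coef n th (al, be) = [forall i : 'I_n, part al i == sig i]%:R.
Proof.
move=> leN is_part_al al0 is_part_be be0 ad lam_dec eta_dec sig_dec lam_le above window eta_w below beE thE.
pose f := schurv n al (@mvar n).
have f_sym (s : 'S_n) (m : 'X_{1..n}) : f@_[multinom m (s i) | i < n] = f@_m.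
  by rewrite -mcoeff_sym schurv_sym.
have co_ext p p' u u' : p =1 p' -> u =1 u' -> shifted_coef f p u = shifted_coef f p' u'.
  move=> ep eu; rewrite /shifted_coef.
  have -> : [forall i, u i <= p i]%N = [forall i, u' i <= p' i]%N.
    by apply: eq_forallb => i; rewrite ep eu.
  by congr (if _ then _@__ else _); apply/mnmP => i; rewrite !mnmE ep eu.
rewrite /product_coef /schurv2 /= [schurv n al _ * _]mulrC mulrA bialternant //.
rewrite (mcoeff_altM _ _ (fun i : 'I_n => shifted n th i)).
have := skew_translate ad lam_dec eta_dec sig_dec lam_le above window eta_w below f_sym.
set lhs := LHS; set rhs := RHS => eq_lr.
transitivity lhs.
  apply: eq_bigr => s _; congr (_ * _); apply: co_ext => i.
    by rewrite /shifted thE ?ltn_ord.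
  by rewrite /shifted beE ?ltn_ord.
rewrite eq_lr; pose q i := (sig i + (n - i.+1))%N.
have antitone_q : antitone n q.
  have dec_le u v : (u <= v)%N -> (sig v <= sig u)%N.
    by move=> /subnK <-; elim: (v - u)%N => // k; apply: leq_trans (sig_dec _).
  by move=> u v /andP [lt ltn]; rewrite /q; have := dec_le _ _ (ltnW lt); lia.
transitivity ((alt (@mvar n) n (shifted n (shape0 N)) * f)@_(mexp n q)).
  rewrite (mcoeff_altM _ _ (fun i : 'I_n => q i)); apply: eq_bigr => s _.
  by congr (_ * _); apply: co_ext => i //; rewrite /shifted part0 add0n.
rewrite bialternant // mcoeff_alt //; last exact: antitone_shifted.
congr (nat_of_bool _)%:R; apply: eq_forallb => i.
by rewrite /shifted /q eqn_add2r.
Qed.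

End Assembly.

(** * Conjugates and complements as shapes *)

Section Windows.

Variables (N m : nat) (la : seq nat).
Hypotheses (sorted_la : sorted geq la) (le_m : head 0 la + size la <= m) (leN : m <= N).

Let conj := mkshape N (nth 0 (conjugate la)).
Let comp := mkshape N (nth 0 (complement m la)).

Lemma part_nth_shape (s : seq nat) : sorted geq s -> size s <= N -> head 0 s <= N ->
  forall i, part (mkshape N (nth 0 s)) i = nth 0 s i.
Proof.
move=> sorted_s size_s head_s i; apply: part_mkshapeE => k.
  by apply: leq_trans head_s; rewrite -nth0; exact: nth_geq.
by move=> leNk; rewrite nth_default // (leq_trans size_s).
Qed.

Lemma is_part_nth_shape (s : seq nat) : sorted geq s -> size s <= N -> head 0 s <= N ->
  is_part (mkshape N (nth 0 s)).
Proof.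
by move=> *; apply/is_partP => i; rewrite !part_nth_shape //; exact: nth_geq.
Qed.

Lemma conjugate_bound : [/\ sorted geq (conjugate la), size (conjugate la) <= m &
  head 0 (conjugate la) <= m].
Proof.
split; first exact: sorted_conjugate.
  by rewrite size_mkseq (leq_trans _ le_m) ?leq_addr.
by rewrite -nth0 (leq_trans (nth_conjugate_le _ _)) // (leq_trans _ le_m) ?leq_addl.
Qed.

Lemma complement_bound : [/\ sorted geq (complement m la), size (complement m la) <= m &
  head 0 (complement m la) <= m].
Proof.
split; [exact: sorted_complement | exact: size_complement | ].
by rewrite -nth0 nth_complement //; case: ifP => // _; rewrite leq_subr.
Qed.

Lemma ltn_part_conj i x : (x < part conj i) = (i < nth 0 la x).
Proof.
have [h1 h2 h3] := conjugate_bound.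
by rewrite part_nth_shape ?ltn_nth_conjugate //; apply: leq_trans leN.
Qed.

Lemma part_comp i : part comp i = if i < m then m - nth 0 la (m - i.+1) else 0.
Proof.
have [h1 h2 h3] := complement_bound.
by rewrite part_nth_shape ?nth_complement //; apply: leq_trans leN.
Qed.

Lemma is_part_conj : is_part conj.
Proof.
by have [h1 h2 h3] := conjugate_bound; apply: is_part_nth_shape => //; apply: leq_trans leN.
Qed.

Lemma is_part_comp : is_part comp.
Proof.
by have [h1 h2 h3] := complement_bound; apply: is_part_nth_shape => //; apply: leq_trans leN.
Qed.

End Windows.

(** * The window at an outer corner and its coefficients *)

Lemma eq_ltn m n : (forall x, (x < m) = (x < n)) -> m = n.
Proof.
move=> H; apply/eqP; rewrite eqn_leq; apply/andP; split; rewrite leqNgt; apply/negP.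
  by rewrite H ltnn.
by rewrite -H ltnn.
Qed.

Lemma leq_pred_sub t k a : t < k - a -> t <= k.-1 - a.
Proof. lia. Qed.

Lemma interval_inj u v u' v' : (forall l, (u <= l < v) = (u' <= l < v')) -> u' < v' ->
  u = u' /\ v = v'.
Proof.
move=> H lt; have /andP [le1 lt1] : u <= u' < v by rewrite H leqnn.
have /andP [_ lt2] : u <= v'.-1 < v by rewrite H; lia.
have /andP [le3 _] : u' <= u < v' by rewrite -H leqnn (leq_ltn_trans le1).
have /andP [_ lt4] : u' <= v.-1 < v' by rewrite -H; lia.
by split; lia.
Qed.

(** The offsets of the self-conjugate shape are read off from its rows: it starts in the column of
    the corner, and it ends with row [k - 1], so [d = k - a]. *)
Lemma corner_window (nu : seq nat) k : sorted geq nu -> corner_symmetric nu ->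
  outer_corner nu (k, nth 0 nu k) -> 0 < k ->
  exists a d eta rho,
    [/\ sorted geq eta, sorted geq rho,
        forall x i, (x < nth 0 rho i) = (i < nth 0 rho x), k = a + d & 0 < d] /\
    [/\ forall i, i < a -> nth 0 nu i = nth 0 eta i,
        forall t, nth 0 nu (a + t) = nth 0 eta (a + t) + nth 0 rho t,
        forall t, (0 < nth 0 rho t) = (t < d) &
        forall t, t <= d -> nth 0 eta (a + t) = nth 0 nu k].
Proof.
move=> sorted_nu nu_cs corner k_gt0; set jj := nth 0 nu k in corner *.
have [eta [[eta_part _ eta_sub] [[rho [a [b [rho_part rho_sc skewE]]]] in_skew out_skew]]] :=
  nu_cs _ _ corner k_gt0.
have [sorted_eta _] := andP eta_part; have [sorted_rho _] := andP rho_part.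
have mono_rho := nth_geq sorted_rho.
have := in_skew; rewrite skewE => /and3P [le_a le_b].
rewrite /diagram /= => in_rho.
(* Otherwise box [(k - 1, b)] would lie in the skew shape, but columns left of [jj] are excluded. *)
have eq_b : b = jj.
  apply/eqP; rewrite eqn_leq le_b /= leqNgt; apply/negP => lt.
  have := out_skew k.-1 b lt; rewrite skewE le_a leqnn /diagram /= subnn.
  by rewrite (leq_ltn_trans _ in_rho).
subst b.
have rowE i l : (nth 0 eta i <= l < nth 0 nu i) =
    [&& a <= i, jj <= l & l < jj + nth 0 rho (i - a)].
  have := skewE i l; rewrite /skew_diagram /diagram /= -leqNgt andbC => ->.
  by case: (leqP a i) => //= _; case: (leqP jj l) => //= lel; rewrite ltn_subLR.
have nu_above i : i < a -> nth 0 nu i = nth 0 eta i.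
  move=> lti; apply/eqP; rewrite eqn_leq eta_sub andbT leqNgt; apply/negP => lt.
  by have := rowE i (nth 0 eta i); rewrite leqnn lt leqNgt lti.
have eta_win t : 0 < nth 0 rho t -> nth 0 eta (a + t) = jj /\ nth 0 nu (a + t) = jj + nth 0 rho t.
  move=> pos; apply: interval_inj => [l|]; last by rewrite -{1}(addn0 jj) ltn_add2l.
  by rewrite rowE leq_addr addKn.
have nu_win t : nth 0 nu (a + t) = nth 0 eta (a + t) + nth 0 rho t.
  have [r0|pos] := posnP (nth 0 rho t); last by have [-> ->] := eta_win t pos.
  rewrite r0 addn0; apply/eqP; rewrite eqn_leq eta_sub andbT leqNgt; apply/negP => lt.
  have := rowE (a + t) (nth 0 eta (a + t)); rewrite leqnn lt addKn r0 addn0.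
  by move/esym/and3P => [_ h1]; rewrite ltnNge h1.
have lt_ak : a < k by move: le_a; rewrite -ltnS prednK.
have eq_k : k = a + (k - a) by rewrite subnKC // ltnW.
(* A box of [rho] here would make row [k] of [nu] longer than [jj]. *)
have rho_d : nth 0 rho (k - a) = 0.
  apply/eqP; rewrite -leqn0 leqNgt; apply/negP => pos.
  have [_] := eta_win _ pos; rewrite -eq_k -/jj => /eqP.
  by rewrite -{1}(addn0 jj) eqn_add2l eq_sym -leqn0 leqNgt pos.
exists a, (k - a), eta, rho; split; split=> //.
- by move=> x i; rewrite -[X in x < nth 0 X i]rho_sc ltn_nth_conjugate.
- by rewrite subn_gt0.
- move=> t; case: (ltnP t (k - a)) => lt; last by apply/negbTE; rewrite -leqNgt -[X in _ <= X]rho_d mono_rho.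
  apply: leq_ltn_trans (leq0n _) (leq_trans in_rho _); apply: mono_rho; exact: leq_pred_sub.
(* The case [t = d] is row [k] itself; it serves for [mu], whose window has one more row. *)
move=> t; rewrite leq_eqVlt => /orP [/eqP ->|lt].
  by have := nu_win (k - a); rewrite rho_d addn0 -eq_k.
apply: (proj1 (eta_win t _)).
apply: leq_ltn_trans (leq0n _) (leq_trans in_rho _); apply: mono_rho; exact: leq_pred_sub.
Qed.

(** From [conjugate la] this leaves the conjugate of the part of [la] in the rows from [a] and
    columns from [j] on; from [complement m la], if [la] fits, the complement in [m - j] rows of
    length [m - a]. *)
Definition window N (la : seq nat) j a : shape N :=
  iter a (@pred_shape N) (iter j (@behead_shape N) (mkshape N (nth 0 la))).

Lemma part_window N la j a i :
  part (window N la j a) i = part (mkshape N (nth 0 la)) (i + j) - a.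
Proof. by rewrite part_iter_pred part_iter_behead. Qed.

Lemma is_part_window N la j a : is_part (mkshape N (nth 0 la)) -> is_part (window N la j a).
Proof. by move=> *; apply: is_part_iter_pred; apply: is_part_iter_behead. Qed.

Section WindowCoefficient.

Variables (N m a d j : nat) (la eta : seq nat) (sig : nat -> nat).
Hypotheses (sorted_la : sorted geq la) (sorted_eta : sorted geq eta).
Hypotheses (le_m : head 0 la + size la <= m) (leN : m <= N).
Hypotheses (le_a : a <= size la) (ad_le : a + d + j <= m).

(** The complement of [eta] in the same rectangle: the shape whose coefficient separates the two
    products. *)
Definition co_eta : shape N :=
  mkshape N (fun i => if i < m - j then m - a - nth 0 eta (m - j - i.+1) else 0).

Lemma part_co_eta i : part co_eta i = if i < m - j then m - a - nth 0 eta (m - j - i.+1) else 0.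
Proof.
apply: (part_mkshapeE (f := fun i => if i < m - j then m - a - nth 0 eta (m - j - i.+1) else 0)) => k.
  by case: ifP => // _; clear -leN; lia.
by move=> le; case: ifP => // lt; clear -lt le leN; lia.
Qed.

Lemma is_part_co_eta : is_part co_eta.
Proof.
apply/is_partP => i; rewrite !part_co_eta; case: ifP => // lt.
by rewrite (ltnW lt) leq_sub2l // nth_geq // leq_sub2l.
Qed.

Lemma window_coef :
  (forall i, sig i.+1 <= sig i) ->
  (forall i, i < a -> nth 0 la i = nth 0 eta i) ->
  (forall t, nth 0 la (a + t) = nth 0 eta (a + t) + sig t) ->
  (forall t, t < d -> nth 0 eta (a + t) = j) ->
  (forall t, d <= t -> sig t = 0) ->
  product_coef (m - j) co_eta (window N (conjugate la) j a, window N (complement m la) j a)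
  = ([forall i : 'I_(m - j), part (window N (conjugate la) j a) i == sig i]%:R)%R.
Proof.
move=> sig_dec above win eta_w below.
have le_jm : j <= m by apply: leq_trans ad_le; rewrite leq_addl.
have mono := nth_geq sorted_la.
(* The rectangle is wide enough because [a <= size la] and [head 0 la + size la <= m]. *)
have la_le i : nth 0 la i <= m - a.
  rewrite leq_subRL; last by apply: leq_trans le_a (leq_trans (leq_addl _ _) le_m).
  apply: leq_trans le_m; rewrite addnC; apply: leq_add => //; rewrite -nth0; exact: mono.
apply: (coef_complement (j := j) (a := a) (d := d) (M := m - a) (lam := nth 0 la) (eta := nth 0 eta)) => //.
- by apply: leq_trans leN; rewrite leq_subr.
- by apply: is_part_window; exact: (is_part_conj sorted_la le_m leN).
- rewrite part_window subnK //; apply/eqP; rewrite subn_eq0.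
  rewrite leqNgt (ltn_part_conj sorted_la le_m leN) -leqNgt (leq_trans (mono 0 a _)) // nth0.
  by apply: leq_trans le_m; rewrite leq_addr.
- by apply: is_part_window; exact: (is_part_comp sorted_la leN).
- by rewrite part_window subnK // part_comp // ltnn.
- by rewrite leq_subRL // addnC.
- by move=> i; exact: mono.
- by move=> i; exact: nth_geq.
- move=> i lti; rewrite part_window part_comp //.
  have -> : i + j < m by clear -lti; lia.
  by rewrite subnAC; congr (_ - nth 0 la _); clear; lia.
by move=> i lti; rewrite part_co_eta lti.
Qed.

End WindowCoefficient.

Lemma dominates_window N m a k (mu nu : seq nat) :
  sorted geq mu -> sorted geq nu ->
  head 0 mu + size mu <= m -> head 0 nu + size nu <= m -> m <= N ->
  (forall i, nth 0 mu i = nth 0 nu i + (i == k)) -> a < k ->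
  let j := nth 0 nu k in
  dominates (mkshape N (nth 0 (conjugate mu)), mkshape N (nth 0 (complement m mu)))
            (mkshape N (nth 0 (conjugate nu)), mkshape N (nth 0 (complement m nu))) ->
  dominates (window N (conjugate mu) j a, window N (complement m mu) j a)
            (window N (conjugate nu) j a, window N (complement m nu) j a).
Proof.
move=> sorted_mu sorted_nu le_mu le_nu leN muE lt_ak j dom.
have mono_mu := nth_geq sorted_mu.
have mu_k : nth 0 mu k = j.+1 by rewrite muE eqxx addn1.
have lt_k : k < size mu by rewrite ltnNge; apply/negP => le; rewrite nth_default in mu_k.
have lt_j : j < head 0 mu by rewrite -nth0 -mu_k; exact: mono_mu.
have nu_le i : nth 0 nu i <= nth 0 mu i by rewrite muE leq_addr.
(* The last [j] rows of the square miss [mu], so the first [j] rows of both complements are full. *)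
have zero i : i < j -> nth 0 mu (m - i.+1) = 0.
  move=> lti; apply: nth_default; clear -lti lt_j le_mu; lia.
(* Likewise the first [a] columns of the complements are full, since [a < size mu] and
   [head 0 mu + size mu <= m]. *)
have comp_pos u i : u < a -> i < m -> u < m - nth 0 mu (m - i.+1).
  move=> ltu lti; have := mono_mu 0 (m - i.+1) (leq0n _); rewrite nth0.
  by clear -ltu lti lt_k lt_ak le_mu; lia.
apply: (@dominates_iter_pred N a (_, _) (_, _)).
- by rewrite /is_part2 /= !is_part_iter_behead ?(is_part_conj sorted_mu le_mu leN) ?(is_part_comp sorted_mu leN).
- by rewrite /is_part2 /= !is_part_iter_behead ?(is_part_conj sorted_nu le_nu leN) ?(is_part_comp sorted_nu leN).
- move=> u ltu i /=; rewrite !part_iter_behead (ltn_part_conj sorted_mu le_mu leN) (ltn_part_conj sorted_nu le_nu leN); split.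
    by rewrite muE ltn_eqF ?addn0 // (ltn_trans ltu).
  rewrite !part_comp //; case: ifP => // lt; rewrite comp_pos //.
  by apply/esym; apply: leq_trans (comp_pos u _ ltu lt) _; rewrite leq_sub2l.
apply: dominates_iter_behead dom => /=.
- by rewrite /is_part2 /= (is_part_conj sorted_mu le_mu leN) (is_part_comp sorted_mu leN).
- by rewrite /is_part2 /= (is_part_conj sorted_nu le_nu leN) (is_part_comp sorted_nu leN).
move=> u ltu; congr (_ + _).
  apply: eq_ltn => x; rewrite (ltn_part_conj sorted_mu le_mu leN) (ltn_part_conj sorted_nu le_nu leN) muE.
  by case: (x =P k) => [->|_]; rewrite ?addn0 // addn1 ltnS ltu ltnW.
rewrite !part_comp //; case: ifP => // _; congr (_ - _).
by have := nu_le (m - u.+1); rewrite zero // leqn0 => /eqP ->.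
Qed.

Theorem mainTheorem8 (nu mu : seq nat)
  (nu_part : is_partition nu) (mu_part : is_partition mu)
  (nu_cs : corner_symmetric nu)
  (size_mu : sumn mu = (sumn nu).+1)
  (nu_sub_mu : part_incl nu mu)
  (mu_neq : mu <> add_box_row1 nu) :
  ~ covers mu nu.
Proof.
have [sorted_nu nu0] := andP nu_part; have [sorted_mu mu0] := andP mu_part.
have mono_nu := nth_geq sorted_nu; have mono_mu := nth_geq sorted_mu.
have [k muE] := added_box size_mu nu_sub_mu.
have k_gt0 : 0 < k.
  rewrite lt0n; apply/eqP => k0; apply: mu_neq; apply: nth_inj_pos => //.
    by rewrite inE /=; apply/negP => /mem_behead h; rewrite h in nu0.
  by move=> i; rewrite muE nth_add_box_row1 k0.
have corner : outer_corner nu (k, nth 0 nu k).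
  split; first by rewrite /diagram /= ltnn.
  exists mu; split=> // -[i l]; rewrite /diagram /= muE xpair_eqE.
  case: (i =P k) => [->|_]; last by rewrite addn0 orbF.
  by rewrite /= addn1 ltnS leq_eqVlt orbC.
have [a [d [eta [rho [[sorted_eta sorted_rho rho_sym eq_k d_gt0] [above win rho_pos eta_w]]]]]] :=
  corner_window sorted_nu nu_cs corner k_gt0.
set j := nth 0 nu k in eta_w.
have rho0 t : d <= t -> nth 0 rho t = 0.
  by move=> le; apply/eqP; rewrite -leqn0 leqNgt rho_pos -leqNgt.
have lt_ak : a < k by rewrite eq_k -{1}(addn0 a) ltn_add2l.
move=> [m [le_m pos_schur]].
have size_le : size nu <= size mu.
  rewrite leqNgt; apply/negP => lt; have := nu_sub_mu (size mu).
  rewrite [nth 0 mu _]nth_default // leqn0 => /eqP e.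
  by move: nu0; rewrite -e mem_nth.
have le_m_nu : head 0 nu + size nu <= m.
  by apply: leq_trans le_m; apply: leq_add => //; rewrite -!nth0 nu_sub_mu.
have [N [ltN dom]] : exists N, m < N /\
    dominates (mkshape N (nth 0 (conjugate mu)), mkshape N (nth 0 (complement m mu)))
              (mkshape N (nth 0 (conjugate nu)), mkshape N (nth 0 (complement m nu))).
  apply: schur_positive_dominates pos_schur => la; rewrite !inE.
  have [c1 c2 c3] := conjugate_bound sorted_mu le_m.
  have [c4 c5 c6] := complement_bound m sorted_mu.
  have [c7 c8 c9] := conjugate_bound sorted_nu le_m_nu.
  have [c10 c11 c12] := complement_bound m sorted_nu.
  by case/or4P => /eqP ->; split=> //; apply: leqW.
have leN := ltnW ltN.
have mu_k : nth 0 mu k = j.+1 by rewrite muE eqxx addn1.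
have lt_k : k < size mu by rewrite ltnNge; apply/negP => le; rewrite nth_default in mu_k.
have lt_j : j < head 0 mu by rewrite -nth0 -mu_k; exact: mono_mu.
have le_kj : k.+1 + j <= m.
  by apply: leq_trans le_m; rewrite addnC; apply: leq_add => //; apply: ltnW.
have n_gt0 : 0 < m - j by rewrite subn_gt0 (leq_trans _ le_kj) // addSn ltnS leq_addl.
have := dominates_window sorted_mu sorted_nu le_m le_m_nu leN muE lt_ak dom.
have ltn : (m - j).-1 < N by rewrite prednK // (leq_trans (leq_subr _ _)).
have is_part_th := is_part_co_eta a j sorted_eta leN.
move/(dominates_coef ltn is_part_th); rewrite prednK //.
rewrite (window_coef (d := d) (sig := nth 0 rho)) //; first last.
- by move=> t /ltnW; exact: eta_w.
- by move=> i; exact: nth_geq.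
- by rewrite -eq_k (leq_trans _ le_kj) // leq_add2r.
- rewrite leqNgt; apply/negP => lt.
  have := rho_pos 0; rewrite d_gt0 => pos.
  have := win 0; rewrite addn0 [nth 0 nu a]nth_default ?(ltnW lt) // => /esym/eqP.
  by rewrite addn_eq0 => /andP [_]; rewrite -leqn0 leqNgt pos.
(* The added box forms row [d], of length one, so the window of [mu] has [d.+1] rows. *)
rewrite (window_coef (d := d.+1) (sig := fun t => nth 0 rho t + (t == d))) //; first last.
- move=> t lt; rewrite rho0 ?(ltnW lt) //; by rewrite gtn_eqF.
- by move=> t; rewrite muE win eq_k eqn_add2l addnA.
- by move=> i lti; rewrite muE above // ltn_eqF ?addn0 // (ltn_trans lti).
(* Row [d - 1] of [rho] is nonempty, so the new row fits below it. *)
- move=> t; case: (t.+1 =P d) => [e|_].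
    by rewrite rho0 ?e // add0n (ltn_eqF (_ : t < d)) -?e // addn0 rho_pos -e.
  by rewrite addn0 (leq_trans (nth_geq sorted_rho (leqnSn t))) // leq_addr.
- by rewrite addnS -eq_k.
- by apply: ltnW (ltn_trans lt_ak lt_k).
(* The coefficient for [nu] is 1 because [rho] is self-conjugate; the rows of [nu] from [k] on have
   length at most [j] and do not reach the window. *)
have -> : [forall i : 'I_(m - j), part (window N (conjugate nu) j a) i == nth 0 rho i].
  apply/forallP => i; apply/eqP; apply: eq_ltn => x.
  rewrite part_window ltn_subRL (ltn_part_conj sorted_nu le_m_nu leN) rho_sym win.
  case: (ltnP x d) => [ltx|lex]; first by rewrite eta_w ?(ltnW ltx) // addnC ltn_add2l.
  rewrite (rho0 x) // ltn0 addn0; apply/negbTE; rewrite -leqNgt.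
  have := win x; rewrite (rho0 x) // addn0 => <-.
  by apply: leq_trans (mono_nu k _ _) _; rewrite ?leq_addl // eq_k leq_add2l.
suff -> : [forall i : 'I_(m - j), part (window N (conjugate mu) j a) i
    == nth 0 rho i + (i == d :> nat)] = false by [].
(* Row 0 already differs: in the conjugated window of [mu] it is longer than [d], while [rho],
   self-conjugate with [d] rows, has at most [d] columns. *)
apply/negbTE; rewrite negb_forall; apply/existsP; exists (Ordinal n_gt0) => /=.
rewrite gtn_eqF //; rewrite (_ : (0 == d) = false) ?addn0; last by case: (d) d_gt0.
apply: (@leq_ltn_trans d); first by rewrite leqNgt rho_sym rho0.
by rewrite part_window ltn_subRL (ltn_part_conj sorted_mu le_m leN) -eq_k add0n mu_k.
Qed.
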